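(* There is an absolute constant $c>0$ such that the following holds. Let $G$ be a compact vector space over $\mathbb{F}_2$, let $\epsilon\in(0,1/100]$, and let $A\subset G$ be a measurable set of density $\alpha$ with $|\alpha-1/3|\le\epsilon$. Then \[ \|\chi_A\|_{A(G)}\ \ge\ c\,\log\log(\epsilon^{-1}). \]
   Context: A compact vector space over $\mathbb{F}_2$ is a compact Hausdorff abelian group $G$ with $x+x=0$ for all $x\in G$. Its dual $\widehat{G}$ is the discrete group of continuous homomorphisms $\gamma:G\to S^1$, written additively; it is a vector space over $\mathbb{F}_2$, and every character takes values in $\{\pm1\}$. $\mu_G$ is the Haar probability measure on $G$, and the density of $A$ is $\mu_G(A)$. The Fourier transform of $f\in L^1(G)$ is $\widehat{f}(\gamma)=\int_G f(x)\overline{\gamma(x)}\,d\mu_G(x)$. $A(G)=\{f\in L^1(G):\|\widehat f\|_{\ell^1(\widehat G)}<\infty\}$ with $\|f\|_{A(G)}=\sum_{\gamma\in\widehat G}|\widehat f(\gamma)|$; this quantity is taken to be $+\infty$ when $f\notin A(G)$. *)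

(* Defs.v *)
From HB Require Import structures.
From mathcomp Require Import all_boot all_order all_algebra.
From mathcomp Require Import all_classical all_reals all_analysis.
From mathcomp Require Import Rstruct Rstruct_topology.
Set Implicit Arguments. Unset Strict Implicit. Unset Printing Implicit Defensive.
Import Order.TTheory GRing.Theory Num.Theory.
Import numFieldNormedType.Exports.
Local Open Scope classical_set_scope.
Local Open Scope ring_scope.

(* Every abelian group is pointed by 0; this alias carries that pointed
   structure, needed only to build the Borel sigma-algebra type. *)
Definition zpointed (G : topologicalZmodType) : Type := G.
Section ZPointed.
Variable G : topologicalZmodType.
HB.instance Definition _ := Choice.on (zpointed G).
HB.instance Definition _ := isPointed.Build (zpointed G) (0 : G).
End ZPointed.

Definition borel (G : topologicalZmodType) :=
  @g_sigma_algebraType (zpointed G) (@open G).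

Definition compact_F2_space (G : topologicalZmodType) : Prop :=
  [/\ compact [set: G], hausdorff_space G & forall x : G, x + x = 0].

Definition is_haar_probability (G : topologicalZmodType)
  (mu : probability (borel G) Rdefinitions.R) : Prop :=
  [/\ (forall (x : G) (A : set G), measurable (A : set (borel G)) ->
         mu [set x + y | y in A] = mu A),
      (forall A : set G, measurable (A : set (borel G)) ->
         mu A = ereal_inf [set mu U | U in [set U : set G | open U /\ A `<=` U]])
    & (forall U : set G, open U ->
         mu U = ereal_sup [set mu K | K in [set K : set G | compact K /\ K `<=` U]])].

(* Characters of G: continuous homomorphisms G -> S^1.  On a compact F_2
   vector space every character takes values in {1, -1} (see context), so
   they are represented as real-valued maps into {1,-1}. *)
Definition character (G : topologicalZmodType) (g : G -> Rdefinitions.R) : Prop :=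
  [/\ continuous g, (forall x, g x = 1 \/ g x = -1)
    & (forall x y, g (x + y) = g x * g y)].

(* Fourier coefficient of the indicator of A at the character g
   (complex conjugation is the identity since g is real valued). *)
Definition fourier_indic (G : topologicalZmodType)
  (mu : probability (borel G) Rdefinitions.R) (A : set G) (g : G -> Rdefinitions.R)
  : \bar Rdefinitions.R :=
  (\int[mu]_x ((\1_A x) * g x)%:E)%E.

Definition A_norm_indic (G : topologicalZmodType)
  (mu : probability (borel G) Rdefinitions.R) (A : set G) : \bar Rdefinitions.R :=
  (\esum_(g in [set g | @character G g]) `| fourier_indic mu A g |)%E.

(* Main.v *)
(** Let [f] be the indicator function of [A], with Fourier norm [M].  For a
    finite subgroup [L] of the dual, of dimension [d], look at the densities
    of [A] on the [2^d] cosets of the annihilator of [L].  If they all lie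
    within [2^-d / 12] of [0] or [1], then the density of [A] lies within
    [2^-d / 12] of a fraction of denominator [2^d], hence at distance at least
    [2^-d / 4] from [1/3].  Otherwise some coset has density [delta] bounded
    away from [0] and [1] by about [2^-d].  Parseval on that coset and a
    dyadic pigeonhole give a level [j] at which the coefficients that are not
    in [L] and at least [2^-j] times the largest one sum to [>> j + 1]; by
    Chang's theorem these coefficients lie in an extension of [L] of dimension
    [O (4^j d)].  So [ln d] grows by [O (j + 1)] while the part of the norm
    carried by [L] grows by [>> j + 1], and the process stops with
    [ln d = O (M)].

    Parseval requires enough continuous characters.  In every finite subgroup
    of [G], Bogolyubov's argument puts the common kernel of boundedly many
    characters inside [U + U + U + U], for any neighbourhood [U] of [0].
    An ultrafilter limit over the finite subgroups gives such characters on
    all of [G], a priori discontinuous; the closure of their common kernel has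
    finite index, so open subgroups form a basis of neighbourhoods of [0].  By
    regularity, [A] is close in measure to a union of cosets of an open
    subgroup, and the problem moves to a finite quotient of [G]. *)

Require Import Defs.
From HB Require Import structures.
From mathcomp Require Import all_boot all_order all_algebra.
From mathcomp Require Import Rstruct Rstruct_topology.
From mathcomp Require Import all_classical all_reals all_analysis.
From mathcomp Require Import ring lra zify.
Set Implicit Arguments. Unset Strict Implicit. Unset Printing Implicit Defensive.
Import Order.TTheory GRing.Theory Num.Theory.
Import numFieldNormedType.Exports.
Local Open Scope ring_scope.

(** * Fourier analysis on F_2^n *)

Lemma addvv_F2 n (x : 'rV['F_2]_n) : x + x = 0.
Proof.
apply/matrixP => i j; rewrite !mxE.
by case: (x i j) => [[|[|]]] //= ?; apply/val_inj.
Qed.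

Section FourierF2.
Variables (R : realType) (n : nat).
Local Notation V := 'rV['F_2]_n.
Implicit Types (a b x y : V) (f g h : V -> R) (L : {set V}).

Definition sgn2 (u : 'F_2) : R := if u == 0 then 1 else -1.

Lemma sgn2D u v : sgn2 (u + v) = sgn2 u * sgn2 v.
Proof.
rewrite /sgn2.
case: u => [[|[|//]]] ?; case: v => [[|[|//]]] ? /=; rewrite ?(mulr1, mul1r) //.
by rewrite mulrNN mulr1.
Qed.

(** The dot product identifies the dual of [V] with [V] itself, so frequencies and points share a
    type and [chiC] can exchange them. *)
Definition chi a x : R := sgn2 ((a *m x^T) 0 0).

Lemma chiDl a b x : chi (a + b) x = chi a x * chi b x.
Proof. by rewrite /chi mulmxDl mxE sgn2D. Qed.

Lemma chiDr a x y : chi a (x + y) = chi a x * chi a y.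
Proof. by rewrite /chi linearD /= mulmxDr mxE sgn2D. Qed.

Lemma chi_pm a x : chi a x = 1 \/ chi a x = -1.
Proof. by rewrite /chi /sgn2; case: ifP; [left|right]. Qed.

Lemma chi0l x : chi 0 x = 1.
Proof. by rewrite /chi mul0mx mxE /sgn2 eqxx. Qed.

Lemma chi_sqr a x : chi a x * chi a x = 1.
Proof. by case: (chi_pm a x) => ->; rewrite ?mulrNN mulr1. Qed.

Lemma norm_chi a x : `|chi a x| = 1.
Proof. by case: (chi_pm a x) => ->; rewrite ?normrN normr1. Qed.

Lemma chi_delta a (i : 'I_n) : chi a (delta_mx 0 i) = sgn2 (a 0 i).
Proof.
rewrite /chi mxE (bigD1 i) //= !mxE !eqxx /= mulr1 big1 ?addr0 // => j ji.
by rewrite !mxE (negbTE ji) andbF mulr0.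
Qed.

Lemma chi_neq0 a : a != 0 -> exists x, chi a x = -1.
Proof.
move=> a0; have [i ai] : exists i, a 0 i != 0.
  apply/existsP; apply: contraR a0; rewrite negb_exists => /forallP a0.
  apply/eqP/matrixP => i j; rewrite ord1 mxE.
  by apply/eqP; rewrite -[_ == _]negbK.
by exists (delta_mx 0 i); rewrite chi_delta /sgn2 (negbTE ai).
Qed.

Lemma chiC a x : chi a x = chi x a.
Proof. by rewrite /chi -[a in LHS]trmxK -trmx_mul mxE. Qed.

Let N : R := #|{: V}|%:R.

Lemma cardV_gt0 : 0 < N.
Proof. by rewrite ltr0n; apply/card_gt0P; exists 0. Qed.

Lemma cardV_neq0 : N != 0.
Proof. by rewrite gt_eqF // cardV_gt0. Qed.

Lemma sum_shift (F : V -> R) b : \sum_x F x = \sum_x F (x + b).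
Proof. by rewrite (reindex_inj (addIr b)). Qed.

Lemma sum_chi a : \sum_x chi a x = if a == 0 then N else 0.
Proof.
case: eqVneq => [->|/chi_neq0 [b ab]].
  by under eq_bigr do rewrite chi0l; rewrite sumr_const.
have : \sum_x chi a x = - \sum_x chi a x.
  rewrite [LHS](sum_shift _ b) -sumrN; apply: eq_bigr => x _.
  by rewrite chiDr ab mulrN1.
by lra.
Qed.

Definition mean f : R := N^-1 * \sum_x f x.

Lemma eq_mean f g : f =1 g -> mean f = mean g.
Proof. by move=> fg; rewrite /mean (eq_bigr _ (fun x _ => fg x)). Qed.

Lemma ler_mean f g : (forall x, f x <= g x) -> mean f <= mean g.
Proof.
move=> fg; rewrite ler_pM2l ?invr_gt0 ?cardV_gt0 //.
by apply: ler_sum => x _.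
Qed.

Lemma meanD f g : mean (fun x => f x + g x) = mean f + mean g.
Proof. by rewrite /mean big_split /= mulrDr. Qed.

Lemma meanZ c f : mean (fun x => c * f x) = c * mean f.
Proof. by rewrite /mean -mulr_sumr mulrCA. Qed.

Lemma mean_cst c : mean (fun=> c) = c.
Proof. by rewrite /mean sumr_const -[c *+ _]mulr_natl mulrA mulVf ?cardV_neq0 ?mul1r. Qed.

Lemma mean_ge0 f : (forall x, 0 <= f x) -> 0 <= mean f.
Proof. by move=> f0; rewrite -[leLHS](mean_cst 0) ler_mean. Qed.

Lemma ler_norm_mean f : `|mean f| <= mean (fun x => `|f x|).
Proof.
have N0 : 0 < N^-1 by rewrite invr_gt0 cardV_gt0.
by rewrite /mean normrM (gtr0_norm N0) ler_pM2l // ler_norm_sum.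
Qed.

Lemma mean_sum (I : finType) (P : pred I) (F : I -> V -> R) :
  mean (fun x => \sum_(i | P i) F i x) = \sum_(i | P i) mean (F i).
Proof. by rewrite /mean exchange_big /= mulr_sumr. Qed.

Lemma mean_exchange (F : V -> V -> R) :
  mean (fun x => mean (F x)) = mean (fun y => mean (fun x => F x y)).
Proof. by rewrite /mean -!mulr_sumr exchange_big. Qed.

Lemma mean_shift f b : mean f = mean (fun x => f (x + b)).
Proof. by rewrite /mean -sum_shift. Qed.

Lemma mean_chi a : mean (chi a) = (a == 0)%:R.
Proof.
rewrite /mean sum_chi; case: eqP => _; last by rewrite mulr0.
by rewrite mulVf ?cardV_neq0.
Qed.

Definition hat f a : R := mean (fun x => f x * chi a x).

Lemma eq_hat f g : f =1 g -> hat f =1 hat g.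
Proof. by move=> fg a; apply: eq_mean => x; rewrite fg. Qed.

Lemma hat0 f : hat f 0 = mean f.
Proof. by apply: eq_mean => x; rewrite chi0l mulr1. Qed.

Lemma hatD f g a : hat (fun x => f x + g x) a = hat f a + hat g a.
Proof. by rewrite /hat -meanD; apply: eq_mean => x; rewrite mulrDl. Qed.

Lemma hatZ c f a : hat (fun x => c * f x) a = c * hat f a.
Proof. by rewrite /hat -meanZ; apply: eq_mean => x; rewrite mulrA. Qed.

Lemma hat_mul_chi f b a : hat (fun x => f x * chi b x) a = hat f (a + b).
Proof. by apply: eq_mean => x; rewrite chiDl -mulrA [chi b x * _]mulrC. Qed.

Lemma addv_eq0 a b : (a + b == 0) = (a == b).
Proof.
apply/eqP/eqP => [ab|->]; last exact: addvv_F2.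
by rewrite -[b]add0r -ab -addrA addvv_F2 addr0.
Qed.

Lemma fourier_inversion f x : f x = \sum_a hat f a * chi a x.
Proof.
have -> : \sum_a hat f a * chi a x = mean (fun y => f y * \sum_a chi a (x + y)).
  rewrite /hat; under eq_bigr do rewrite mulrC -meanZ.
  rewrite -mean_sum; apply: eq_mean => y; rewrite mulr_sumr.
  by apply: eq_bigr => a _; rewrite chiDr; ring.
have -> : mean (fun y => f y * \sum_a chi a (x + y)) =
    mean (fun y => if y == x then N * f y else 0).
  apply: eq_mean => y; under eq_bigr do rewrite chiC.
  by rewrite sum_chi addv_eq0 eq_sym; case: eqP; rewrite ?mulr0 // mulrC.
rewrite /mean -big_mkcond big_pred1_eq mulrA mulVf ?mul1r //.
exact: cardV_neq0.
Qed.

Lemma parseval f : \sum_a hat f a ^+ 2 = mean (fun x => f x ^+ 2).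
Proof.
rewrite -[RHS]/(mean (fun x => f x * f x)).
have -> : mean (fun x => f x * f x) =
          mean (fun x => \sum_a hat f a * (f x * chi a x)).
  apply: eq_mean => x; rewrite [X in _ * X]fourier_inversion mulr_sumr.
  by apply: eq_bigr => a _; ring.
rewrite mean_sum; apply: eq_bigr => a _.
by rewrite meanZ expr2.
Qed.

Lemma ler_norm_hat f a : `|hat f a| <= mean (fun x => `|f x|).
Proof.
apply: le_trans (ler_norm_mean _) _; apply: ler_mean => x.
by rewrite normrM norm_chi mulr1.
Qed.

(** In characteristic two [x + y] is [x - y], so this is the usual convolution. *)
Definition conv f g x : R := mean (fun y => f y * g (x + y)).

Lemma hat_conv f g a : hat (conv f g) a = hat f a * hat g a.
Proof.
have -> : hat (conv f g) a =
          mean (fun y => f y * chi a y * mean (fun x => g (x + y) * chi a (x + y))).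
  rewrite /hat -[LHS]/(mean (fun x => conv f g x * chi a x)).
  under eq_mean do rewrite mulrC -meanZ.
  rewrite mean_exchange; apply: eq_mean => y; rewrite -meanZ.
  apply: eq_mean => x; rewrite chiDr -[in LHS](mulr1 (chi a x)) -(chi_sqr a y).
  by ring.
under eq_mean do rewrite -(mean_shift (fun x => g x * chi a x)) mulrC.
by rewrite meanZ mulrC.
Qed.

(** * Subspaces of the dual and densities on cosets of their annihilators *)

Definition subsp L d :=
  [/\ 0 \in L, {in L &, forall a b, a + b \in L} & #|L| = (2 ^ d)%N].

Lemma subsp0 : subsp [set 0] 0.
Proof.
split; rewrite ?inE ?cards1 // => a b; rewrite !inE => /eqP -> /eqP ->.
by rewrite addr0.
Qed.

Definition adjoin L b := L :|: [set a + b | a in L].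

Lemma subsp_addr L d a b : subsp L d -> a \in L -> (b + a \in L) = (b \in L).
Proof.
move=> [_ LD _] aL; apply/idP/idP => [baL|bL]; last exact: LD.
by rewrite -[b]addr0 -(addvv_F2 a) addrA LD.
Qed.

Lemma in_adjoin L d a b : subsp L d ->
  (a \in adjoin L b) = (a \in L) || (a + b \in L).
Proof.
move=> sL; rewrite inE; congr (_ || _).
apply/imsetP/idP => [[c cL ->]|abL]; first by rewrite -addrA addvv_F2 addr0.
by exists (a + b) => //; rewrite -addrA addvv_F2 addr0.
Qed.

Lemma subsp_adjoin L d b : subsp L d -> b \notin L -> subsp (adjoin L b) d.+1.
Proof.
move=> sL bL; have [L0 LD cL] := sL; split; first by rewrite inE L0.
- move=> x y; rewrite !(in_adjoin _ _ sL) => /orP[xL|xL] /orP[yL|yL].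
  + by rewrite (LD x y).
  + by rewrite -addrA (LD x (y + b)) ?orbT.
  + by rewrite [x + y + b]addrAC (LD (x + b) y) ?orbT.
  + by have := LD _ _ xL yL; rewrite addrACA addvv_F2 addr0 => ->.
- rewrite cardsU card_imset; last exact: addIr.
  rewrite cL (_ : _ :&: _ = finset.set0) ?cards0 ?subn0 ?addnn -?muln2 ?expnSr //.
  apply/setP => x; rewrite !inE; apply/negP => /andP[xL /imsetP[a aL xE]].
  by move: xL; rewrite xE addrC (subsp_addr _ sL aL) (negbTE bL).
Qed.

Lemma subsp_card L d : subsp L d -> #|L|%:R = 2 ^+ d :> R.
Proof. by case=> _ _ ->; rewrite natrX. Qed.

Lemma subsp_card_gt0 L d : subsp L d -> 0 < #|L|%:R :> R.
Proof. by move=> /subsp_card ->; rewrite exprn_gt0. Qed.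

Lemma sum_subsp_shift L d (F : V -> R) b : subsp L d -> b \in L ->
  \sum_(a in L) F a = \sum_(a in L) F (a + b).
Proof.
move=> sL bL; rewrite (reindex_inj (addIr b)).
by apply: eq_bigl => a; rewrite (subsp_addr _ sL).
Qed.

(* The indicator function of the coset of the annihilator of [L] through [x0]. *)
Definition cosetind L x0 x : R := #|L|%:R^-1 * \sum_(a in L) chi a (x + x0).

(** If some [b] in [L] has [chi b (x + x0) = -1], translating the sum over [L] by [b] changes its
    sign, so it vanishes. *)
Lemma cosetindE L d x0 x : subsp L d ->
  cosetind L x0 x = [forall (a | a \in L), chi a (x + x0) == 1]%:R.
Proof.
move=> sL; rewrite /cosetind; case: (boolP [forall (a | _), _]) => [/forall_inP L1|].
  rewrite (eq_bigr (fun=> 1)); last by move=> a aL; apply/eqP/L1.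
  by rewrite sumr_const mulVf // gt_eqF // (subsp_card_gt0 sL).
rewrite negb_forall => /existsP[b]; rewrite negb_imply => /andP[bL b1].
have {}b1 : chi b (x + x0) = -1.
  by case: (chi_pm b (x + x0)) b1 => // ->; rewrite eqxx.
have : \sum_(a in L) chi a (x + x0) = - \sum_(a in L) chi a (x + x0).
  rewrite [LHS](sum_subsp_shift _ sL bL) -sumrN.
  by apply: eq_bigr => a _; rewrite chiDl b1 mulrN1.
move=> E; have -> : \sum_(a in L) chi a (x + x0) = 0 by lra.
by rewrite mulr0.
Qed.

Lemma hat_cosetind_mul L x0 f b :
  hat (fun x => cosetind L x0 x * f x) b =
  #|L|%:R^-1 * \sum_(a in L) chi a x0 * hat f (b + a).
Proof.
rewrite /hat -[LHS]/(mean (fun x => cosetind L x0 x * f x * chi b x)).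
under [in RHS]eq_bigr do rewrite -meanZ.
rewrite -mean_sum -meanZ; apply: eq_mean => x.
rewrite /cosetind -!mulrA; congr (_ * _); rewrite mulr_suml.
by apply: eq_bigr => a _; rewrite chiDl chiDr; ring.
Qed.

(** The average of [f] over the coset of the annihilator of [L] through [x0], in Fourier form: in
    [mean_cosetind_mul] the factor [#|L|%:R^-1] is the measure of the coset. *)
Definition dens L f x0 := \sum_(a in L) chi a x0 * hat f a.

Lemma mean_cosetind_mul L x0 f :
  mean (fun x => cosetind L x0 x * f x) = #|L|%:R^-1 * dens L f x0.
Proof.
rewrite -hat0 hat_cosetind_mul; congr (_ * _).
by apply: eq_bigr => a _; rewrite add0r.
Qed.

Lemma hat_cosetind L d x0 b : subsp L d ->
  hat (cosetind L x0) b = if b \in L then #|L|%:R^-1 * chi b x0 else 0.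
Proof.
move=> sL; have -> : hat (cosetind L x0) b = hat (fun x => cosetind L x0 x * 1) b.
  by apply: eq_hat => x; rewrite mulr1.
have hat1 a : hat (fun=> 1) a = (a == 0)%:R.
  by rewrite -mean_chi; apply: eq_mean => x; rewrite mul1r.
rewrite hat_cosetind_mul; under eq_bigr do rewrite hat1 addv_eq0.
case: ifPn => bL; last first.
  rewrite big1 ?mulr0 // => a aL; case: eqP => [ba|_]; last by rewrite mulr0.
  by rewrite ba aL in bL.
rewrite (bigD1 b) //= eqxx mulr1 big1 ?addr0 // => a /andP[_ ab].
by rewrite eq_sym (negbTE ab) mulr0.
Qed.

(** For [b] in [L] the character [chi b] is constant on the coset. *)
Lemma hat_cosetind_mul_in L d x0 f b : subsp L d -> b \in L ->
  hat (fun x => cosetind L x0 x * f x) b =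
  chi b x0 * mean (fun x => cosetind L x0 x * f x).
Proof.
move=> sL bL; rewrite -meanZ; apply: eq_mean => x.
rewrite (cosetindE _ _ sL); case: (boolP [forall (a | _), _]) => [/forall_inP L1|_].
  have /eqP := L1 _ bL; rewrite chiDr => b1.
  suff -> : chi b x = chi b x0 by ring.
  by rewrite -[RHS]mul1r -b1 -mulrA chi_sqr mulr1.
by rewrite !mul0r mulr0.
Qed.

(** Apply [expR s <= (1 - s)^-1] at [s = t - 2 * t ^+ 2] and at [s = - t - 2 * t ^+ 2]; the two
    right-hand sides sum to at most [2]. *)
Lemma cosh_le (t : R) : (expR t + expR (- t)) / 2 <= expR (2 * t ^+ 2).
Proof.
have expR_le (s : R) : s < 1 -> expR s <= (1 - s)^-1.
  move=> s1; rewrite -[expR s]invrK -expRN lef_pV2 ?posrE ?expR_gt0 ?subr_gt0 //.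
  exact: expR_ge1Dx.
have t2 := sqr_ge0 t.
have e1 : expR t * expR (- (2 * t ^+ 2)) <= (1 - (t - 2 * t ^+ 2))^-1.
  by rewrite -expRD; apply: expR_le; nra.
have e2 : expR (- t) * expR (- (2 * t ^+ 2)) <= (1 - (- t - 2 * t ^+ 2))^-1.
  by rewrite -expRD; apply: expR_le; nra.
rewrite -[leRHS]mul1r -ler_pdivrMr ?expR_gt0 // -expRN.
have e3 : (1 - (t - 2 * t ^+ 2))^-1 + (1 - (- t - 2 * t ^+ 2))^-1 <= 2.
  have p1 : 0 < 1 - (t - 2 * t ^+ 2) by nra.
  have p2 : 0 < 1 - (- t - 2 * t ^+ 2) by nra.
  rewrite -[X in X + _]mul1r -[X in _ + X]mul1r addf_div ?gt_eqF //.
  by rewrite ler_pdivrMr ?mulr_gt0 //; nra.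
by nra.
Qed.

(* Chang's theorem, by Chernoff's method: characters that are independent
   modulo [L] are independent signs on the coset. *)
Section Chang.
Variables (L : {set V}) (d : nat) (f : V -> R) (x0 : V) (rho : R).
Hypotheses (sL : subsp L d) (f01 : forall x, 0 <= f x <= 1) (rho0 : 0 < rho).
Hypothesis (dens0 : 0 < dens L f x0).

Let w := cosetind L x0.
Let g := fun x => w x * f x.
(** This value maximizes [t * rho - 2 * t ^+ 2], the gain from correlation minus the loss in
    [cosh_le]; the maximum is [rho ^+ 2 / 8]. *)
Let t := rho / 4.

Let w_ge0 x : 0 <= w x.
Proof. by rewrite /w (cosetindE _ _ sL) ler0n. Qed.

(** Invariant after [k] choices: [u] stands for [t] times a sum of [k] signed characters, and
    [expR u] is a Riesz product. The vanishing of coefficients outside [L'] makes the next character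
    average to zero, so each choice multiplies the mean by exactly cosh t. *)
Let riesz L' k (u : V -> R) :=
  [/\ subsp L' (d + k), L \subset L',
      forall a, a \notin L' -> hat (fun x => w x * expR (u x)) a = 0,
      mean (fun x => w x * expR (u x)) =
        ((expR t + expR (- t)) / 2) ^+ k / #|L|%:R
    & t * rho * k%:R * mean g <= mean (fun x => g x * u x)].

Let riesz0 : riesz L 0 (fun=> 0).
Proof.
have E : (fun x => w x * expR 0) =1 w by move=> x; rewrite expR0 mulr1.
split; rewrite ?addn0 //.
- by move=> a aL; rewrite (eq_hat E) (hat_cosetind _ _ sL) (negbTE aL).
- have [L0 _ _] := sL.
  by rewrite (eq_mean E) -hat0 (hat_cosetind _ _ sL) L0 chi0l expr0 mulr1 mul1r.
- rewrite mulr0 mul0r; have -> : mean (fun x => g x * 0) = mean (fun=> 0).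
    by apply: eq_mean => x; rewrite mulr0.
  by rewrite mean_cst.
Qed.

Let rieszS L' k u a : riesz L' k u -> a \notin L' -> rho * mean g <= `|hat g a| ->
  exists u', riesz (adjoin L' a) k.+1 u'.
Proof.
move=> [sL' LL' suppu meanu gu] aL' ga.
pose c : R := if 0 <= hat g a then 1 else -1.
have c2 : c = 1 \/ c = -1 by rewrite /c; case: ifP; [left|right].
have cg : c * hat g a = `|hat g a|.
  rewrite /c; case: ifPn => [h|]; first by rewrite mul1r ger0_norm.
  by rewrite -ltNge => h; rewrite mulN1r ltr0_norm.
(* [A] and [B] are cosh t and sinh t: for a sign [e], [expR (t * e) = A + B * e]. *)
pose A : R := (expR t + expR (- t)) / 2.
pose B : R := (expR t - expR (- t)) / 2.
pose u' x := u x + t * (c * chi a x).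
have eE x : w x * expR (u' x) =
    A * (w x * expR (u x)) + B * c * (w x * expR (u x) * chi a x).
  have -> : expR (u' x) = expR (u x) * (A + B * (c * chi a x)).
    rewrite /u' expRD; congr (_ * _).
    have [->|->] : c * chi a x = 1 \/ c * chi a x = -1.
      case: c2 => ->; case: (chi_pm a x) => ->;
        rewrite ?mulrNN ?mulr1 ?mul1r; by [left|right].
    - by rewrite /A /B !mulr1; field.
    - by rewrite /A /B !mulrN1; field.
  by ring.
have hatE b : hat (fun x => w x * expR (u' x)) b =
   A * hat (fun x => w x * expR (u x)) b +
   B * c * hat (fun x => w x * expR (u x)) (b + a).
  by rewrite (eq_hat eE) hatD !hatZ hat_mul_chi.
exists u'; split.
- by rewrite addnS; apply: subsp_adjoin.
- by apply: fintype.subset_trans LL' _; apply: finset.subsetUl.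
- move=> b; rewrite (in_adjoin _ _ sL') negb_or => /andP[bL' baL'].
  by rewrite hatE !suppu // !mulr0 addr0.
- rewrite -hat0 hatE add0r (suppu a) // mulr0 addr0 hat0 meanu exprS.
  by rewrite -/A; ring.
- have -> : mean (fun x => g x * u' x) = mean (fun x => g x * u x) + t * `|hat g a|.
    rewrite -cg mulrA -meanZ -meanD; apply: eq_mean => x; rewrite /u'; ring.
  have t0 : 0 < t by rewrite divr_gt0.
  rewrite -natr1; have : t * (rho * mean g) <= t * `|hat g a| by rewrite ler_pM2l.
  by lra.
Qed.

(** The mean of [g * expR u] is bounded below by convexity, using the tangent of the exponential at
    [m], and above by [f <= 1] and the exact mean of the Riesz product. *)
Let riesz_bound L' k u : riesz L' k u ->
  expR (k%:R * rho ^+ 2 / 8) * dens L f x0 <= 1.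
Proof.
move=> [sL' LL' suppu meanu gu].
have iL0 : 0 < #|L|%:R^-1 :> R by rewrite invr_gt0 (subsp_card_gt0 sL).
have mg : mean g = #|L|%:R^-1 * dens L f x0 by exact: mean_cosetind_mul.
set m := t * rho * k%:R in gu.
have g_ge0 x : 0 <= g x by rewrite mulr_ge0 //; case/andP: (f01 x).
have low : expR m * mean g <= mean (fun x => g x * expR (u x)).
  have le : expR m * mean g <=
      mean (fun x => expR m * (1 - m) * g x + expR m * (g x * u x)).
    rewrite meanD !meanZ; have := expR_gt0 m => em.
    by have : expR m * (m * mean g) <= expR m * mean (fun x => g x * u x);
       [rewrite ler_pM2l|lra].
  apply: le_trans le _; apply: ler_mean => x.
  have -> : expR m * (1 - m) * g x + expR m * (g x * u x) =
            g x * (expR m * (1 + (u x - m))) by ring.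
  apply: ler_wpM2l => //; rewrite -[in leRHS](subrKC m (u x)) expRD.
  by rewrite ler_pM2l ?expR_gt0 // expR_ge1Dx.
have up : mean (fun x => g x * expR (u x)) <= expR (2 * t ^+ 2 * k%:R) * #|L|%:R^-1.
  have le : mean (fun x => g x * expR (u x)) <= mean (fun x => w x * expR (u x)).
    apply: ler_mean => x; rewrite ler_pM2r ?expR_gt0 //.
    by rewrite -[leRHS]mulr1 ler_wpM2l //; case/andP: (f01 x).
  apply: le_trans le _; rewrite meanu ler_pM2r // [2 * _ * _]mulrC expRM_natl.
  apply: lerXn2r; last exact: cosh_le; rewrite nnegrE ?expR_ge0 //.
have := le_trans low up; rewrite mg mulrCA [leRHS]mulrC ler_pM2l // => le.
have -> : k%:R * rho ^+ 2 / 8 = m - 2 * t ^+ 2 * k%:R by rewrite /m /t; field.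
by rewrite expRD expRN mulrAC ler_pdivrMr ?expR_gt0 // mul1r.
Qed.

(** Greedy choice: while a large coefficient lies outside [L'], adjoin it. If this never stopped,
    [riesz_bound] would hold for all [k], and [expR y >= 1 + y] refutes it once [k] exceeds [X]. *)
Lemma chang : exists L' k, [/\ subsp L' (d + k), L \subset L',
   expR (k%:R * rho ^+ 2 / 8) * dens L f x0 <= 1
 & forall a, rho * mean g <= `|hat g a| -> a \in L'].
Proof.
apply: contrapT => H.
have ex k : exists L' u, riesz L' k u.
  elim: k => [|k [L' [u ru]]]; first by exists L, (fun=> 0).
  have [a [aL' ga]] : exists a, a \notin L' /\ rho * mean g <= `|hat g a|.
    apply: contrapT => H'; apply: H; exists L', k.
    have ? := riesz_bound ru; case: ru => *; split => // a ga.
    by apply: contrapT => /negP aL'; apply: H'; exists a.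
  by have [u' ru'] := rieszS ru aL' ga; exists (adjoin L' a), u'.
pose X : R := (dens L f x0)^-1 / (rho ^+ 2 / 8).
have r2 : 0 < rho ^+ 2 / 8 by rewrite divr_gt0 ?exprn_gt0.
have X0 : 0 <= X by rewrite divr_ge0 ?invr_ge0 ?ltW.
have [L' [u /riesz_bound]] := ex (Num.trunc X).+1.
rewrite -ler_pdivlMr // mul1r; apply/negP; rewrite -ltNge.
apply: lt_le_trans (expR_ge1Dx _).
have : X < (Num.trunc X).+1%:R by rewrite truncnS_gt.
by rewrite /X ltr_pdivrMr // mulrA; lra.
Qed.

End Chang.

End FourierF2.

Arguments sgn2 {R} u.
Arguments chi {R n} a x.
Arguments cosetind {R n} L x0 x.

(** * The energy increment *)

Section Pigeonhole.
Variable R : realType.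

Lemma exists_expr2_ge (x : R) : exists J : nat, x <= 2 ^+ J.
Proof.
exists (Num.trunc x).+1; apply: le_trans (ltW (truncnS_gt x)) _.
by rewrite -natrX ler_nat ltnW // ltn_expl.
Qed.

Lemma sum_dyadic (J : nat) :
  \sum_(j < J) (2 ^- j * j.+1%:R : R) = 4 - (2 * J%:R + 4) * 2 ^- J.
Proof.
elim: J => [|J IH]; first by rewrite big_ord0 expr0 invr1; lra.
have p : 2 ^+ J != 0 :> R by rewrite expf_neq0.
by rewrite big_ord_recr /= IH -natr1 exprS; field.
Qed.

(** From [J] to [J.+1] the tail term drops by [2 ^- J]. If [v] passes the new threshold, the new
    layer restores this amount; otherwise the remaining tail [2 ^- J] already dominates [v / s]. *)
Lemma dyadic_layers (s v : R) (J : nat) : 0 <= v <= s ->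
  v <= s * (2 * 2 ^- J + \sum_(j < J) 2 ^- j * (2 ^- j * s <= v)%R%:R).
Proof.
move=> /andP[v0 vs].
elim: J => [|J IH]; first by rewrite big_ord0 expr0 invr1; lra.
have p : 2 ^+ J != 0 :> R by rewrite expf_neq0.
rewrite big_ord_recr /=; set S := \sum_(_ < _) _ in IH *.
have E : 2 / 2 ^+ J.+1 = 2 ^- J :> R by rewrite exprS; field.
rewrite E; case: (lerP (2 ^- J * s) v) => h /=.
  by rewrite mulr1; lra.
have S0 : 0 <= S by apply: sumr_ge0 => j _; rewrite mulr_ge0 ?invr_ge0 ?exprn_ge0.
have := mulr_ge0 (le_trans v0 vs) S0.
by rewrite mulr0 addr0; lra.
Qed.

(** If every level sum were below [j.+1 / 20], weighting the levels by [2 ^- j] would bound the sum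
    of squares by [s * (4 / 20 + 1 / 10)], less than [2 / 5 * s]. The [4] is the bound from
    [sum_dyadic]; [J] is chosen to make the tail at most [1 / 10]. *)
Lemma dyadic_pigeonhole (T : finType) (P : pred T) (v : T -> R) (s : R) :
  0 < s -> (forall i, P i -> 0 <= v i <= s) ->
  2 / 5 * s <= \sum_(i | P i) v i ^+ 2 ->
  exists j : nat,
    j.+1%:R / 20 <= \sum_(i | P i && (2 ^- j * s <= v i)) v i.
Proof.
move=> s0 vs lev2; apply: contrapT => /forallNP H.
pose M := \sum_(i | P i) v i.
have M0 : 0 <= M by apply: sumr_ge0 => i /vs /andP[].
have [J leJ] := exists_expr2_ge (20 * M).
pose m j := \sum_(i | P i && (2 ^- j * s <= v i)) v i.
have lem j : 2 ^- j * m j <= 2 ^- j * j.+1%:R / 20.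
  rewrite -mulrA ler_pM2l ?invr_gt0 ?exprn_gt0 //.
  by have /negP := H j; rewrite -ltNge => /ltW.
have E : \sum_(i | P i) v i ^+ 2 <=
    s * (2 * 2 ^- J * M + \sum_(j < J) 2 ^- j * m j).
  have -> : \sum_(j < J) 2 ^- j * m j = \sum_(i | P i) \sum_(j < J)
      2 ^- j * (if 2 ^- j * s <= v i then v i else 0).
    by rewrite exchange_big; apply: eq_bigr => j _; rewrite /m big_mkcondr mulr_sumr.
  rewrite /M mulr_sumr -big_split /= mulr_sumr; apply: ler_sum => i Pi.
  have /andP[v0 _] := vs i Pi.
  have := ler_wpM2l v0 (dyadic_layers J (vs i Pi)); rewrite -expr2 => h.
  apply: le_trans h _; rewrite mulrCA ler_pM2l // mulrDr [v i * (2 * _)]mulrC lerD2l.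
  rewrite mulr_sumr; apply: ler_sum => j _.
  by case: ifP => _; rewrite ?mulr1 ?mulr0 // mulrC.
have S4 : \sum_(j < J) 2 ^- j * m j <= 4 / 20.
  apply: le_trans (ler_sum _ (fun (j : 'I_J) _ => lem j)) _.
  rewrite -mulr_suml sum_dyadic ler_pM2r ?invr_gt0 //.
  by rewrite gerBl mulr_ge0 ?invr_ge0 ?exprn_ge0 // addr_ge0 ?mulr_ge0.
have J1 : 2 * 2 ^- J * M <= 10^-1.
  rewrite mulrAC ler_pdivrMr ?exprn_gt0 //; lra.
have : s * (2 * 2 ^- J * M + \sum_(j < J) 2 ^- j * m j) <= s * (10^-1 + 4 / 20).
  by rewrite ler_pM2l // lerD.
by lra.
Qed.

End Pigeonhole.

(** * One enlargement of the subspace *)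

Section Increment.
Variables (R : realType) (n : nat).
Local Notation V := 'rV['F_2]_n.
Implicit Types (f : V -> R) (L : {set V}).

Lemma expR_ge_expr2 (k : nat) : 2 ^+ k <= expR k%:R :> R.
Proof.
rewrite -[k%:R]mulr1 expRM_natl; apply: lerXn2r; rewrite ?nnegrE ?expR_ge0 //.
by have := expR_ge1Dx (1 : R); lra.
Qed.

(** Restriction to a coset averages coefficients, up to signs, over translates by [L], and
    [L' :\: L] is invariant under these translations. *)
Lemma sum_hat_cosetind_mul L L' d d' f x0 :
  subsp L d -> subsp L' d' -> L \subset L' ->
  \sum_(a in L' :\: L) `|hat (fun x => cosetind L x0 x * f x) a| <=
  \sum_(a in L' :\: L) `|hat f a|.
Proof.
move=> sL sL' /fintype.subsetP LL'; have cL := subsp_card_gt0 R sL.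
apply: (@le_trans _ _ (#|L|%:R^-1 *
    \sum_(b in L) \sum_(a in L' :\: L) `|hat f (a + b)|)).
  rewrite exchange_big /= mulr_sumr; apply: ler_sum => a _.
  rewrite hat_cosetind_mul normrM ger0_norm ?invr_ge0 ?ler0n //.
  rewrite ler_pM2l ?invr_gt0 //; apply: le_trans (ler_norm_sum _ _ _) _.
  by apply: ler_sum => b _; rewrite normrM norm_chi mul1r.
rewrite (eq_bigr (fun=> \sum_(a in L' :\: L) `|hat f a|)).
  by rewrite sumr_const -[X in _ * X]mulr_natl mulrA mulVf ?mul1r ?gt_eqF.
move=> b bL; rewrite [RHS](reindex_inj (addIr b)) /=.
by apply: eq_bigl => a; rewrite !inE (subsp_addr _ sL) // (subsp_addr _ sL') // LL'.
Qed.

(** [f] will be a density function on a quotient, and [eta] measures how far it is from an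
    indicator. By Parseval the squared coefficients of [g] sum to at least [s - eta]; those in [L]
    contribute [s * D <= s / 2], which leaves [2 / 5 * s] outside [L] for the pigeonhole. [chang] is
    then used with [rho = 2 ^- j]. *)
Lemma increment_le_half L d f x0 (eta : R) :
  subsp L d -> (forall x, 0 <= f x <= 1) ->
  mean (fun x => f x * (1 - f x)) <= eta -> eta <= 4 ^- (d + 4) ->
  2 ^- d / 12 <= dens L f x0 <= 1 / 2 ->
  exists L' d' j, [/\ subsp L' d', L \subset L',
    (d' + 4 <= 9 * 4 ^ j * (d + 4))%N &
    j.+1%:R / 20 <= \sum_(a in L' :\: L) `|hat f a|].
Proof.
move=> sL f01 feta etale /andP[dlo dhi].
pose w := @cosetind R n L x0; pose g x := w x * f x.
set D := dens L f x0 in dlo dhi.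
have w01 x : w x = 0 \/ w x = 1.
  by rewrite /w (cosetindE _ _ _ sL); case: FiniteQuant.quant0b; [right|left].
have cL : #|L|%:R = 2 ^+ d :> R by exact: subsp_card.
have p0 : 0 < 2 ^- d :> R by rewrite invr_gt0 exprn_gt0.
have D0 : 0 < D by apply: lt_le_trans dlo; rewrite divr_gt0.
pose s := mean g.
have sE : s = 2 ^- d * D by rewrite /s /g mean_cosetind_mul cL.
have s0 : 0 < s by rewrite sE mulr_gt0.
have g0 x : 0 <= g x.
  by rewrite /g; case: (w01 x) => ->; rewrite ?mul0r ?mul1r //; case/andP: (f01 x).
(* Here [s >= 4 ^- d / 12], whereas [eta <= 4 ^- d / 256]. *)
have etas : eta <= s / 10.
  have q4 : 4 ^- (d + 4) = 2 ^- d * 2 ^- d / 256 :> R.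
    rewrite exprD invfM -[2 ^- d * _]invfM -exprMn.
    by congr (_ ^- _ * _^-1); ring.
  have : 2 ^- d * (2 ^- d / 12) <= s by rewrite sE ler_pM2l.
  by have := mulr_gt0 p0 p0; lra.
have lev2 : 2 / 5 * s <= \sum_(a | a \notin L) `|hat g a| ^+ 2.
  have := parseval g; rewrite (bigID (mem L)) /=.
  rewrite (eq_bigr (fun=> s ^+ 2)); last first.
    move=> a aL; rewrite /g (hat_cosetind_mul_in _ _ sL) // exprMn.
    by rewrite [_ ^+ 2]expr2 chi_sqr mul1r.
  rewrite sumr_const -[X in X + _]mulr_natl cL.
  have -> : \sum_(a | a \notin L) `|hat g a| ^+ 2 = \sum_(a | a \notin L) hat g a ^+ 2.
    by apply: eq_bigr => a _; rewrite real_normK ?num_real.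
  have le1 : s - eta <= mean (fun x => g x ^+ 2).
    have : mean g <= mean (fun x => g x ^+ 2 + f x * (1 - f x)).
      apply: ler_mean => x; rewrite /g; case: (w01 x) => ->; last by lra.
      by have /andP[] := f01 x; nra.
    by rewrite meanD -/s; lra.
  have -> : 2 ^+ d * s ^+ 2 = s * D.
    by rewrite sE; field; rewrite expf_neq0.
  have : s * D <= s * (1 / 2) by rewrite ler_pM2l.
  by lra.
have gs a : a \notin L -> 0 <= `|hat g a| <= s.
  move=> _; rewrite normr_ge0 /=; apply: le_trans (ler_norm_hat _ _) _.
  by apply: ler_mean => x; rewrite ger0_norm.
have [j jle] := dyadic_pigeonhole s0 gs lev2.
have r0 : 0 < 2 ^- j :> R by rewrite invr_gt0 exprn_gt0.
have [L' [k [sL' LL' kle L'P]]] := chang sL f01 r0 D0.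
exists L', (d + k)%N, j; split => //.
  (* Since [12 <= 2 ^+ 4], the density is at least [2 ^- (d + 4)]; this is the origin of the shift
     by [4]. *)
  have kle2 : (k <= 8 * 4 ^ j * (d + 4))%N.
    have : expR (k%:R * (2 ^- j) ^+ 2 / 8) <= expR (d + 4)%:R :> R.
      apply: le_trans (expR_ge_expr2 _).
      rewrite -ler_pdivlMr // mul1r in kle; apply: le_trans kle _.
      rewrite -[leRHS]invrK lef_pV2 ?posrE ?invr_gt0 ?exprn_gt0 //.
      apply: le_trans dlo; rewrite exprD invfM ler_pM2l // lef_pV2 ?posrE //; lra.
    have -> : (2 ^- j) ^+ 2 = (4 ^ j)%:R^-1 :> R.
      by rewrite natrX exprVn -exprM mulnC exprM -natrX.
    rewrite ler_expR ler_pdivrMr // ler_pdivrMr ?ltr0n ?expn_gt0 //.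
    by rewrite -!natrM ler_nat -mulnA mulnC.
  have := leq_pmull (d + 4) (expn_gt0 4 j : 0 < 4 ^ j)%N.
  move: kle2; rewrite -!mulnA; move: (4 ^ j * (d + 4))%N => r; lia.
apply: le_trans (sum_hat_cosetind_mul f x0 sL sL' LL').
apply: le_trans jle _; rewrite -/w -/g.
rewrite [leRHS](bigID (fun a => 2 ^- j * s <= `|hat g a|)) /=.
rewrite [X in _ <= X + _](eq_bigl (fun a => (a \notin L) && (2 ^- j * s <= `|hat g a|))).
  by rewrite lerDl sumr_ge0.
move=> a; rewrite !inE; case: (boolP (_ <= _)) => [/L'P ->|]; by rewrite ?andbF ?andbT.
Qed.

End Increment.

(** * Iteration and the bound on F_2^n *)

Section FiniteTheorem.
Variables (R : realType) (n : nat).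
Local Notation V := 'rV['F_2]_n.
Implicit Types (f : V -> R) (L : {set V}).

Lemma hat_compl f a : hat (fun x => 1 - f x) a = (a == 0)%:R - hat f a.
Proof.
rewrite -mean_chi -mulN1r -hatZ -[X in X + _](eq_mean (f := fun x => 1 * chi a x)).
  by rewrite -hatD; apply: eq_hat => x; ring.
by move=> x; rewrite mul1r.
Qed.

Lemma dens_compl L d f x0 : subsp L d ->
  dens L (fun x => 1 - f x) x0 = 1 - dens L f x0.
Proof.
move=> [L0 _ _]; rewrite /dens; under eq_bigr do rewrite hat_compl mulrBr.
rewrite big_split sumrN /= (bigD1 0) //= eqxx chi0l mulr1 big1 ?addr0 //.
by move=> a /andP[_ /negbTE ->]; rewrite mulr0.
Qed.

(** Densities above [1 / 2] are handled by [1 - f], whose coefficients off [L] are those of [f] up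
    to sign because [0] lies in [L]. *)
Lemma increment L d f x0 (eta : R) :
  subsp L d -> (forall x, 0 <= f x <= 1) ->
  mean (fun x => f x * (1 - f x)) <= eta -> eta <= 4 ^- (d + 4) ->
  2 ^- d / 12 <= dens L f x0 <= 1 - 2 ^- d / 12 ->
  exists L' d' j, [/\ subsp L' d', L \subset L',
    (d' + 4 <= 9 * 4 ^ j * (d + 4))%N &
    j.+1%:R / 20 <= \sum_(a in L' :\: L) `|hat f a|].
Proof.
move=> sL f01 feta etale /andP[dlo dhi].
have [le12|gt12] := lerP (dens L f x0) (1 / 2).
  by apply: (increment_le_half (x0 := x0) sL f01 feta etale); rewrite dlo.
have [|||L' [d' [j [sL' LL' dj le]]]] :=
    increment_le_half (f := fun x => 1 - f x) (x0 := x0) (eta := eta) sL _ _ etale.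
- by move=> x; have /andP[] := f01 x; lra.
- by under eq_mean do rewrite subKr mulrC.
- by rewrite (dens_compl _ _ sL); lra.
exists L', d', j; split => //; apply: le_trans le _; apply: ler_sum => a.
rewrite inE => /andP[aL _]; rewrite hat_compl; case: eqP => [a0|_].
  by case: sL aL; rewrite a0 => ->.
by rewrite sub0r normrN.
Qed.

(** A step multiplies [d + 4] by at most [9 * 4 ^ j <= 16 ^ j.+1 <= expR (4 * j.+1)] and adds
    [j.+1 / 20] to the norm carried by [L]; since [4 = 80 / 20], the exponential bound on [d + 4]
    persists. Each step gains at least [1 / 20], so [m] bounds the number of steps left. *)
Lemma iterate_increment (m : nat) f (M eta : R) L d :
  (forall x, 0 <= f x <= 1) -> \sum_a `|hat f a| <= M ->
  mean (fun x => f x * (1 - f x)) <= eta ->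
  (forall k, (k + 4)%:R <= 4 * expR (80 * M) -> eta <= 4 ^- (k + 4)) ->
  subsp L d -> (d + 4)%:R <= 4 * expR (80 * \sum_(a in L) `|hat f a|) ->
  M - \sum_(a in L) `|hat f a| < m%:R / 20 ->
  exists L' d', [/\ subsp L' d', (d' + 4)%:R <= 4 * expR (80 * M) &
    forall x0, ~~ (2 ^- d' / 12 <= dens L' f x0 <= 1 - 2 ^- d' / 12)].
Proof.
move=> f01 fM feta etaP.
have leM (A : {set V}) : \sum_(a in A) `|hat f a| <= M.
  apply: le_trans fM; rewrite [leRHS](bigID (mem A)) /= lerDl.
  exact: sumr_ge0.
elim: m L d => [|m IH] L d sL dL Mm; first by have := leM L; lra.
have dM : (d + 4)%:R <= 4 * expR (80 * M).
  by apply: le_trans dL _; rewrite ler_pM2l // ler_expR ler_pM2l.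
have [[x0 x0P]|H] := pselect (exists x0, 2 ^- d / 12 <= dens L f x0 <= 1 - 2 ^- d / 12);
  last first.
  by exists L, d; split => // x0; apply/negP => ?; apply: H; exists x0.
have [L' [d' [j [sL' LL' dj le]]]] := increment sL f01 feta (etaP _ dM) x0P.
have SE : \sum_(a in L') `|hat f a| =
    \sum_(a in L) `|hat f a| + \sum_(a in L' :\: L) `|hat f a|.
  by rewrite (big_setID L) /= (finset.setIidPr LL').
apply: (IH L' d' sL').
- have j1 : 80 * \sum_(a in L) `|hat f a| + j.+1%:R * 4 <=
            80 * \sum_(a in L') `|hat f a| by rewrite SE; lra.
  apply: (@le_trans _ _ (4 * expR (80 * \sum_(a in L) `|hat f a| + j.+1%:R * 4)));
    last by rewrite ler_pM2l // ler_expR.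
  have e4 : 9 * 4 ^+ j <= expR (j.+1%:R * 4) :> R.
    rewrite expRM_natl; apply: (@le_trans _ _ (16 ^+ j.+1)).
      have : 4 ^+ j <= 16 ^+ j :> R by rewrite lerXn2r ?nnegrE //; lra.
      have : 0 <= 4 ^+ j :> R by rewrite exprn_ge0.
      by rewrite exprS; lra.
    rewrite lerXn2r ?nnegrE ?expR_ge0 //.
    by apply: le_trans (expR_ge_expr2 R 4); lra.
  rewrite expRD; have : (d' + 4)%:R <= 9 * 4 ^+ j * (d + 4)%:R :> R.
    by rewrite -natrX -!natrM ler_nat.
  move=> h; apply: le_trans h _; rewrite mulrC mulrA.
  by apply: ler_pM => //; rewrite mulr_ge0 ?exprn_ge0.
- rewrite SE; move: Mm le; rewrite -[m.+1%:R]natr1 -[j.+1%:R]natr1.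
  by have := ler0n R j; lra.
Qed.

(** * Cosets of annihilators and the distance from 1/3 *)

Definition ann_coset L (x : V) : {set V} := [set y | [forall (a | a \in L), chi a (y + x) == 1 :> R]].

Lemma ann_cosetP L (x y : V) :
  reflect (forall a, a \in L -> chi a y = chi a x :> R) (y \in ann_coset L x).
Proof.
rewrite inE; apply: (iffP forall_inP) => H a aL.
  have /eqP := H a aL; rewrite chiDr => E.
  by rewrite -[RHS]mul1r -E -mulrA chi_sqr mulr1.
by rewrite chiDr H // chi_sqr.
Qed.

Lemma mean_indic (A : {set V}) : mean (fun x => (x \in A)%:R : R) = #|{: V}|%:R^-1 * #|A|%:R.
Proof.
rewrite /mean (eq_bigr (fun x => if x \in A then 1 else 0)).
  by rewrite -big_mkcond sumr_const.
by move=> x _; case: ifP.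
Qed.

Lemma card_ann_coset L d (x : V) : subsp L d -> (#|ann_coset L x| * 2 ^ d = #|{: V}|)%N.
Proof.
move=> sL; apply/eqP; rewrite -(eqr_nat R) natrM natrX.
have [L0 _ _] := sL.
have : mean (@cosetind R n L x) = 2 ^- d.
  by rewrite -hat0 (hat_cosetind _ _ _ sL) L0 chi0l mulr1 (subsp_card _ sL).
rewrite (eq_mean (g := fun y => (y \in ann_coset L x)%:R)); last first.
  by move=> y; rewrite (cosetindE _ _ _ sL) inE.
have N0 := cardV_neq0 R n; rewrite mean_indic => E.
by rewrite -(mulVKf N0 #|ann_coset L x|%:R) E mulfVK ?expf_neq0.
Qed.

Lemma dens_ann_coset L f (x y : V) : y \in ann_coset L x -> dens L f y = dens L f x.
Proof. by move=> /ann_cosetP yx; apply: eq_bigr => a /yx ->. Qed.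

Lemma mean_dens L d f : subsp L d -> mean (dens L f) = mean f.
Proof.
move=> [L0 _ _]; rewrite /dens mean_sum -hat0.
under eq_bigr do rewrite -(eq_mean (fun x => mulrC (hat f _) (chi _ x))) meanZ mean_chi.
rewrite (bigD1 0) //= eqxx mulr1 big1 ?addr0 // => a /andP[_ /negbTE ->].
by rewrite mulr0.
Qed.

(** [T] is a disjoint union of cosets of the same size, and [q] counts them. *)
Lemma card_ann_coset_closed L d (T : {set V}) : subsp L d ->
  (forall x y, x \in T -> y \in ann_coset L x -> y \in T) ->
  exists q, (#|T| * 2 ^ d = q * #|{: V}|)%N.
Proof.
move=> sL TP.
have self x : x \in ann_coset L x by apply/ann_cosetP.
have annE x y : (ann_coset L x == ann_coset L y) = (y \in ann_coset L x).
  apply/eqP/idP => [->//|/ann_cosetP yx]; apply/setP => z.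
  by apply/ann_cosetP/ann_cosetP => zx a aL; rewrite zx // yx.
exists #|preim_partition (ann_coset L) T|.
rewrite (card_uniform_partition (n := #|ann_coset L 0|) _ (preim_partitionP (ann_coset L) T)).
  by rewrite -mulnA (card_ann_coset _ sL).
move=> _ /imsetP[x xT ->].
apply/eqP; rewrite -(eqn_pmul2r (expn_gt0 2 d : 0 < 2 ^ d)%N); apply/eqP.
rewrite (card_ann_coset 0 sL) -(card_ann_coset x sL); congr (#|pred_of_set _| * _)%N.
apply/finset.setP => y; rewrite finset.in_set /= annE andbC.
by case: (boolP (y \in ann_coset L x)) => // /(TP _ _ xT) ->.
Qed.

(** The integer [3 * q - 2 ^ d] is nonzero, as [3] does not divide a power of two. *)
Lemma dyadic_far_from_third (q d : nat) : 2 ^- d / 3 <= `|q%:R / 2 ^+ d - 3^-1| :> R.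
Proof.
have p0 : 0 < 2 ^+ d :> R by rewrite exprn_gt0.
have -> : q%:R / 2 ^+ d - 3^-1 = (3 * q%:R - 2 ^+ d) / (3 * 2 ^+ d) :> R.
  by field; rewrite expf_neq0.
rewrite normrM normfV [`|3 * 2 ^+ d|]ger0_norm; last by rewrite mulr_ge0 // ltW.
rewrite ler_pdivlMr ?mulr_gt0 // (_ : _ * _ = 1); last by field; rewrite expf_neq0.
have : (3 * q != 2 ^ d)%N.
  apply/eqP => E; have : (3 %| 2 ^ d)%N by rewrite -E dvdn_mulr.
  by rewrite Euclid_dvdX //; case/andP.
rewrite neq_ltn -natrX -natrM => /orP[h|h].
  have : (3 * q)%:R + 1 <= (2 ^ d)%:R :> R by rewrite natr1 ler_nat.
  by move=> ?; rewrite ler0_norm; lra.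
have : (2 ^ d)%:R + 1 <= (3 * q)%:R :> R by rewrite natr1 ler_nat.
by move=> ?; rewrite ger0_norm; lra.
Qed.

Lemma dens_bounds L d f x0 : subsp L d -> (forall x, 0 <= f x <= 1) ->
  0 <= dens L f x0 <= 1.
Proof.
move=> sL f01; have iL0 : 0 < #|L|%:R^-1 :> R by rewrite invr_gt0 (subsp_card_gt0 _ sL).
have w0 x : 0 <= cosetind L x0 x :> R by rewrite (cosetindE _ _ _ sL) ler0n.
have [L0 _ _] := sL.
have mw : mean (@cosetind R n L x0) = #|L|%:R^-1.
  by rewrite -hat0 (hat_cosetind _ _ _ sL) L0 chi0l mulr1.
apply/andP; split.
  rewrite -(pmulr_rge0 _ iL0) -mean_cosetind_mul mean_ge0 // => x.
  by rewrite mulr_ge0 //; case/andP: (f01 x).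
rewrite -(ler_pM2l iL0) -mean_cosetind_mul mulr1 -mw ler_mean // => x.
by rewrite -[leRHS]mulr1 ler_wpM2l //; case/andP: (f01 x).
Qed.

(** [T] rounds each coset density to [0] or [1], which moves the mean by at most [2 ^- d / 12] to a
    multiple of [2 ^- d]; then [1 / 3 - 1 / 12 = 1 / 4]. *)
Lemma mean_far_from_third L d f : subsp L d -> (forall x, 0 <= f x <= 1) ->
  (forall x0, ~~ (2 ^- d / 12 <= dens L f x0 <= 1 - 2 ^- d / 12)) ->
  2 ^- d / 4 <= `|mean f - 3^-1|.
Proof.
move=> sL f01 H.
pose T : {set V} := [set x | 2^-1 < dens L f x].
have [q qE] : exists q, (#|T| * 2 ^ d = q * #|{: V}|)%N.
  apply: (card_ann_coset_closed sL) => x y.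
  by rewrite [x \in T]inE [y \in T]inE => xT /(dens_ann_coset f) ->.
have p0 : 0 < 2 ^+ d :> R by rewrite exprn_gt0.
have mT : mean (fun x => (x \in T)%:R) = q%:R / 2 ^+ d :> R.
  have N0 := cardV_neq0 R n; rewrite mean_indic; apply: (mulfI N0).
  rewrite mulVKf // mulrA; apply/(canRL (mulfK (lt0r_neq0 p0))).
  by rewrite -natrX -!natrM qE mulnC.
have pV : 2 ^- d <= 1 :> R by rewrite invf_le1 // exprn_ege1 //; lra.
have near : `|mean f - q%:R / 2 ^+ d| <= 2 ^- d / 12.
  rewrite -mT -(mean_dens f sL) -mulN1r -meanZ -meanD.
  apply: le_trans (ler_norm_mean _) _.
  rewrite -[leRHS](mean_cst n); apply: ler_mean => x.
  have /andP[D0 D1] := dens_bounds x sL f01.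
  have := H x; rewrite inE negb_and -!ltNge.
  case: (ltrP 2^-1 (dens L f x)) => h /= /orP[h'|h']; rewrite ?mulr1 ?mulr0 ?addr0;
    rewrite ler_norml; lra.
have far := dyadic_far_from_third q d.
have := ler_normB (q%:R / 2 ^+ d - mean f) (3^-1 - mean f).
rewrite opprB addrA subrK [`|q%:R / _ - mean f|]distrC [`|3^-1 - _|]distrC.
by lra.
Qed.

(** The precision [4 ^- B] suffices for every dimension that the iteration, started at the zero
    subspace, can reach. At the end [2 ^- d / 4 <= eps] yields
    [ln eps^-1 <= d + 4 <= 4 * expR (80 * M)]. *)
Theorem loglog_finite f (M eps : R) (B : nat) :
  (forall x, 0 <= f x <= 1) -> \sum_a `|hat f a| <= M ->
  4 * expR (80 * M) <= B%:R -> mean (fun x => f x * (1 - f x)) <= 4 ^- B ->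
  0 < eps -> eps <= 100^-1 -> `|mean f - 3^-1| <= eps ->
  ln (ln eps^-1) <= 100 * M.
Proof.
move=> f01 fM MB feta eps0 eps1 feps.
have hat0M : `|hat f 0| <= M.
  by apply: le_trans fM; rewrite (bigD1 0) //= lerDl sumr_ge0.
have M3 : 3 / 10 <= M.
  move: feps hat0M; rewrite hat0 ler_norml => /andP[h _]; have := ler_norm (mean f).
  by lra.
have [|||L [d [sL dM H]]] := @iterate_increment (Num.trunc (20 * M)).+1 f M (4 ^- B)
  [set 0] 0 f01 fM feta _ (subsp0 n).
- move=> k kM; have kB : (k + 4 <= B)%N by rewrite -(ler_nat R); apply: le_trans MB.
  by rewrite lef_pV2 ?posrE ?exprn_gt0 // ler_weXn2l // (ler_nat R 1 4).
- rewrite add0n ler_peMr // -expR0 ler_expR mulr_ge0 ?sumr_ge0 //.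
- have := truncnS_gt (20 * M).
  have : 0 <= \sum_(a in [set (0 : V)]) `|hat f a| by apply: sumr_ge0.
  by lra.
have far := le_trans (mean_far_from_third sL f01 H) feps.
have lneps : ln eps^-1 <= 4 * expR (80 * M).
  apply: le_trans dM; rewrite -[leRHS]expRK ler_ln ?posrE ?invr_gt0 ?expR_gt0 //.
  apply: le_trans (expR_ge_expr2 R (d + 4)).
  rewrite -[leRHS]invrK lef_pV2 ?posrE ?invr_gt0 ?exprn_gt0 //.
  apply: le_trans far; rewrite exprD invfM.
  have : 0 < 2 ^- d :> R by rewrite invr_gt0 exprn_gt0.
  by lra.
have ln0 : 0 < ln eps^-1.
  by rewrite ln_gt0 //; apply: (@lt_le_trans _ _ 100); [lra|rewrite -[100]invrK lef_pV2 ?posrE ?invr_gt0].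
(* The [2] comes from [4 <= expR 2]; it is absorbed into [20 * M] because [M >= 3 / 10]. *)
apply: (@le_trans _ _ (2 + 80 * M)); last by lra.
rewrite -[leRHS]expRK ler_ln ?posrE ?expR_gt0 //; apply: le_trans lneps _.
by rewrite expRD ler_pM2r ?expR_gt0 //; apply: le_trans (expR_ge_expr2 R 2); lra.
Qed.

End FiniteTheorem.

(** * Bogolyubov's argument *)

Section Bogolyubov.
Variables (R : realType) (n : nat).
Local Notation V := 'rV['F_2]_n.

Lemma mean_gt0 (f : V -> R) : 0 < mean f -> exists x, 0 < f x.
Proof.
move=> f0; apply: contrapT => /forallNP H.
suff : mean f <= 0 by rewrite leNgt f0.
rewrite -(mean_cst n 0); apply: ler_mean => x.
by rewrite leNgt; apply/negP.
Qed.

(** The columns of [A] are the frequencies in the large spectrum, at most [2 * K ^ 2] of them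
    whatever [n] is. On their common kernel the fourfold convolution is positive: the frequency [0]
    gives [sg ^+ 4], the rest of the spectrum is nonnegative, and the frequencies outside contribute
    at least [- (sg ^+ 4 / 2)]. *)
Lemma bogolyubov (S : {set V}) (K : nat) : (#|{: V}| <= K * #|S|)%N ->
  exists A : 'M['F_2]_(n, 2 * K ^ 2), forall x : V, x *m A = 0 ->
    exists s : V * V * (V * V), [/\ s.1.1 \in S, s.1.2 \in S, s.2.1 \in S, s.2.2 \in S &
      x = s.1.1 + s.1.2 + (s.2.1 + s.2.2)].
Proof.
move=> SK; pose f : V -> R := fun x => (x \in S)%:R.
pose sg := mean f; have N0 := cardV_gt0 R n.
have sgK : 1 <= K%:R * sg.
  rewrite /sg mean_indic mulrCA ler_pdivlMl // mulr1 -natrM ler_nat //.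
have sg0 : 0 < sg.
  rewrite ltNge; apply/negP => h; have := mulr_ge0_le0 (ler0n R K) h; lra.
have sg1 : sg <= 1.
  by rewrite -[leRHS](mean_cst n); apply: ler_mean => x; rewrite /f; case: (x \in S).
have sumsq : \sum_a hat f a ^+ 2 = sg.
  by rewrite parseval; apply: eq_mean => x; rewrite /f; case: (x \in S); rewrite ?expr1n ?expr0n.
pose spec : {set V} := [set a | sg ^+ 3 / 2 <= hat f a ^+ 2].
have cspec : (#|spec| <= 2 * K ^ 2)%N.
  have h1 : #|spec|%:R * (sg ^+ 3 / 2) <= sg.
    rewrite -[leRHS]sumsq [leRHS](bigID (mem spec)) /=.
    apply: (@le_trans _ _ (\sum_(a in spec) hat f a ^+ 2)).
      rewrite mulr_natl -sumr_const; apply: ler_sum => a; rewrite inE //.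
    by rewrite lerDl sumr_ge0 // => a _; rewrite sqr_ge0.
  have h2 : #|spec|%:R * sg ^+ 2 <= 2.
    rewrite -(ler_pM2l sg0); move: h1; rewrite !exprS expr0; lra.
  have K2 : 1 <= (K%:R * sg) ^+ 2 by rewrite exprn_ege1.
  rewrite -(ler_nat R) natrM natrX -(ler_pM2r (exprn_gt0 2 sg0)).
  by apply: le_trans h2 _; rewrite -mulrA -exprMn ler_peMr.
(* Columns beyond the size of [spec] are filled with the trivial character. *)
exists (\matrix_(i, j) (nth 0 (enum spec) j) 0 i) => x xA.
have chi1 a : a \in spec -> chi a x = 1 :> R.
  move=> aS; have aE : a \in enum spec by rewrite mem_enum.
  have ik : (index a (enum spec) < 2 * K ^ 2)%N.
    by apply: leq_trans cspec; rewrite cardE index_mem.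
  have := congr1 (fun A : 'rV_(2 * K ^ 2) => A 0 (Ordinal ik)) xA; rewrite !mxE => E.
  rewrite /chi mxE (_ : \sum_j _ = 0) ?/sgn2 ?eqxx // -[RHS]E.
  by apply: eq_bigr => i _; rewrite !mxE /= nth_index // mulrC.
pose h := conv f f.
have r0 : 0 < conv h h x.
  rewrite [conv h h x]fourier_inversion.
  under eq_bigr do rewrite !hat_conv -2!expr2.
  rewrite (bigID (mem spec)) /=.
  have lo : sg ^+ 4 <= \sum_(a in spec) (hat f a ^+ 2) ^+ 2 * chi a x.
    have s0 : 0 \in spec.
      by rewrite inE hat0 -/sg exprS; have := exprn_gt0 2 sg0; nra.
    rewrite (bigD1 0) //= hat0 chi0l mulr1 -exprM lerDl sumr_ge0 // => a /andP[aS _].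
    by rewrite chi1 // mulr1 sqr_ge0.
  have hi : - (sg ^+ 4 / 2) <= \sum_(a | a \notin spec) (hat f a ^+ 2) ^+ 2 * chi a x.
    have : - (sg ^+ 3 / 2 * \sum_(a | a \notin spec) hat f a ^+ 2) <=
           \sum_(a | a \notin spec) (hat f a ^+ 2) ^+ 2 * chi a x.
      rewrite mulr_sumr -sumrN; apply: ler_sum => a; rewrite inE -ltNge => /ltW aS.
      have a2 := sqr_ge0 (hat f a); have := ler_wpM2r a2 aS; rewrite -expr2.
      by have := sqr_ge0 (hat f a ^+ 2); case: (chi_pm R a x) => ->; lra.
    apply: le_trans; rewrite lerN2 (_ : sg ^+ 4 / 2 = sg ^+ 3 / 2 * sg); last by ring.
    apply: ler_wpM2l; first by rewrite divr_ge0 // exprn_ge0 // ltW.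
    rewrite -[leRHS]sumsq [leRHS](bigID (mem spec)) /= lerDr sumr_ge0 // => a _.
    exact: sqr_ge0.
  by have := exprn_gt0 4 sg0; lra.
have hP z : 0 <= h z.
  by apply: mean_ge0 => y; rewrite /f mulr_ge0.
have hS z : 0 < h z -> exists s1 s2, [/\ s1 \in S, s2 \in S & z = s1 + s2].
  move=> /mean_gt0[y]; rewrite /f.
  case: (boolP (y \in S)) => yS; rewrite ?mul0r ?ltxx // mul1r.
  case: (boolP (z + y \in S)) => zyS; rewrite ?ltxx // => _.
  by exists (z + y), y; split => //; rewrite -addrA addvv_F2 addr0.
have [y yP] := mean_gt0 r0.
have hy : 0 < h y.
  by rewrite lt_neqAle hP andbT; apply: contraTneq yP => <-; rewrite mul0r ltxx.
have hxy : 0 < h (x + y).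
  by rewrite lt_neqAle hP andbT; apply: contraTneq yP => <-; rewrite mulr0 ltxx.
have [s1 [s2 [s1S s2S yE]]] := hS _ hy; have [s3 [s4 [s3S s4S xyE]]] := hS _ hxy.
exists ((s1, s2), (s3, s4)); split => //=.
by rewrite -yE -xyE addrC -addrA addvv_F2 addr0.
Qed.

End Bogolyubov.

Local Open Scope classical_set_scope.
Local Open Scope ring_scope.

(** * Open subgroups of compact groups of exponent two *)

(** Finite subsets of [T], listed as sequences and directed by inclusion; used for the ultrafilter
    limit and for extracting finite covers. *)
Definition eventually_seq (T : eqType) : set_system (seq T) :=
  filter_from [set: seq T] (fun s0 => [set s : seq T | {subset s0 <= s}]).

Global Instance eventually_seq_filter (T : eqType) : ProperFilter (@eventually_seq T).
Proof.
apply: filter_from_proper => [|s _]; last by exists s.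
apply: filter_from_filter => [|s1 s2 _ _]; first by exists [::].
exists (s1 ++ s2) => // s sub; split => x xs; apply: sub; rewrite mem_cat xs ?orbT //.
Qed.

Lemma eventually_seq_mem (T : eqType) (x : T) : @eventually_seq T [set s : seq _ | x \in s].
Proof. by exists [:: x] => // s /(_ x); rewrite mem_seq1 eqxx; apply. Qed.

(** * Algebra of groups of exponent two *)

Section F2Groups.
Variable G : zmodType.
Hypothesis char2 : forall x : G, x + x = 0.

Lemma addKK (x y : G) : x + y + y = x.
Proof. by rewrite -addrA char2 addr0. Qed.

(** Coordinates on a finite subgroup containing [s], so that finite Fourier analysis applies. A
    generator outside the image adds one coordinate. *)
Lemma F2_span (s : seq G) : exists m (psi : 'rV['F_2]_m -> G),
  [/\ {morph psi : a b / a + b}, injective psi & forall x, x \in s -> exists b, psi b = x].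
Proof.
elim: s => [|x s [m [psi [psiD psiI psiS]]]].
  exists 0%N, (fun=> 0); split; [by move=> a b; rewrite addr0| |by []].
  by move=> a b _; apply/matrixP => i [].
have [[b bx]|nx] := pselect (exists b, psi b = x).
  exists m, psi; split => // y; rewrite inE => /orP[/eqP ->|/psiS//].
  by exists b.
pose bit (u : 'F_2) : G := if u == 0 then 0 else x.
have bitD u v : bit (u + v) = bit u + bit v.
  rewrite /bit; case: u => [[|[|//]]] ?; case: v => [[|[|//]]] ? /=;
  by rewrite ?(addr0, add0r, char2).
pose psi' (b : 'rV['F_2]_(1 + m)) := bit (lsubmx b 0 0) + psi (rsubmx b).
have psi0 : psi 0 = 0 by apply: (addrI (psi 0)); rewrite -psiD !addr0.
have psi'D : {morph psi' : a b / a + b}.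
  by move=> a b; rewrite /psi' !linearD /= psiD mxE bitD addrACA.
have psi'0 b : psi' b = 0 -> b = 0.
  rewrite /psi' /bit; case: eqP => [b0|_ E].
    rewrite add0r -psi0 => /psiI br; rewrite -[b]hsubmxK br.
    rewrite (_ : lsubmx b = 0) ?row_mx0 //.
    by apply/matrixP => i j; rewrite !ord1 [LHS]b0 mxE.
  by exfalso; apply: nx; exists (rsubmx b); rewrite -[RHS](addKK _ (psi (rsubmx b))) E add0r.
exists (1 + m)%N, psi'; split => // [a b ab|y].
  apply/eqP; rewrite -addv_eq0; apply/eqP/psi'0.
  by rewrite psi'D ab char2.
rewrite inE => /orP[/eqP ->|/psiS[b <-]].
  exists (row_mx 1 0); rewrite /psi' row_mxKl row_mxKr psi0 addr0.
  by rewrite /bit mxE.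
exists (row_mx 0 b); rewrite /psi' row_mxKl row_mxKr.
by rewrite /bit mxE eqxx add0r.
Qed.

(** For each [x] the values [gam_ s x] lie in a finite set, so an ultrafilter finer than
    [eventually_seq] selects one. Each required property involves finitely many points and passes to
    the limit. *)
Lemma limit_hom (k : nat) (P : set G) :
  (forall s : seq G, exists gam : G -> 'rV['F_2]_k,
    (forall x y, x \in s -> y \in s -> gam (x + y) = gam x + gam y) /\
    (forall x, x \in s -> gam x = 0 -> P x)) ->
  exists gam : G -> 'rV['F_2]_k, {morph gam : x y / x + y} /\
    (forall x, gam x = 0 -> P x).
Proof.
move=> /choice[gam_ gamP].
have [F [uF subF]] := ultraFilterLemma (@eventually_seq_filter G).
have pF : ProperFilter F := ultra_proper.
have ex x : exists v, F [set s | gam_ s x = v].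
  apply: contrapT => /forallNP H.
  have /filter_forall : forall v, F (~` [set s | gam_ s x = v]).
    by move=> v; have [/H|] := in_ultra_setVsetC [set s | gam_ s x = v] uF.
  by move=> /filter_ex[s]; apply.
have [gam gamF] := choice ex.
exists gam; split => [x y|x gx].
  have : F ([set s : seq _ | x \in s] `&` [set s : seq _ | y \in s] `&`
      ([set s | gam_ s x = gam x] `&` [set s | gam_ s y = gam y] `&`
       [set s | gam_ s (x + y) = gam (x + y)])).
    by repeat apply: filterI => //; apply: subF; apply: eventually_seq_mem.
  move=> /filter_ex[s [[/= xs ys] [[/= <- <-] <-]]].
  by have [-> //] := gamP s.
have : F ([set s : seq _ | x \in s] `&` [set s | gam_ s x = gam x]).
  by apply: filterI => //; apply: subF; apply: eventually_seq_mem.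
move=> /filter_ex[s [/= xs]]; rewrite gx; have [_] := gamP s; exact.
Qed.

Definition subgroup2 (N : set G) := N 0 /\ forall x y, N x -> N y -> N (x + y).

(** Go through [s]: a [y] with neither [y] nor [x + y] in [M] can be adjoined to [M] without
    capturing [x]. *)
Lemma index2_subgroup (s : seq G) (N : set G) (x : G) : subgroup2 N -> ~ N x ->
  exists M, [/\ subgroup2 M, N `<=` M, ~ M x & forall y, y \in s -> M y \/ M (x + y)].
Proof.
move=> sN Nx; elim: s => [|y s [M [[M0 MD] NM Mx Ms]]]; first by exists N; split.
have [My|nMy] := pselect (M y \/ M (x + y)).
  exists M; split => // z; rewrite inE => /orP[/eqP ->//|/Ms//].
exists [set z | M z \/ M (z + y)]; split.
- split => [|a b]; first by left.
  move=> [aM|aM] [bM|bM]; [left; exact: MD|right|right|left].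
  + by rewrite -addrA; apply: MD.
  + by rewrite addrAC; apply: MD.
  + by rewrite -[a + b]addr0 -(char2 y) addrACA; apply: MD.
- by move=> z /NM; left.
- by move=> [//|?]; apply: nMy; right.
- move=> z; rewrite inE => /orP[/eqP ->|/Ms[zM|zM]]; first by left; right; rewrite char2.
  + by left; left.
  + by right; left.
Qed.

(** Coordinates are added until the kernel shrinks to [N]: a [y] outside [N] that [phi] kills is
    detected by the indicator [del] of the complement of an index-two subgroup containing [N]. *)
Lemma F2_quotient (s : seq G) (N : set G) : subgroup2 N ->
  (forall x, exists2 y, y \in s & N (x + y)) ->
  exists n (phi : G -> 'rV['F_2]_n),
    [/\ {morph phi : x y / x + y}, (forall v, exists x, phi x = v) &
        forall x, phi x = 0 <-> N x].
Proof.
move=> sN sP; have [N0 ND] := sN.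
suff H (t : seq G) : exists n (phi : G -> 'rV['F_2]_n),
    [/\ {morph phi : x y / x + y}, (forall v, exists x, phi x = v),
        forall x, N x -> phi x = 0 & forall x, x \in t -> phi x = 0 -> N x].
  have [n [phi [phiD phiS phiN phis]]] := H s.
  exists n, phi; split => // x; split => [px|/phiN//].
  have [y ys xy] := sP x; rewrite -[x](addKK _ y); apply: ND => //.
  by apply: phis => //; have := phiN _ xy; rewrite phiD px add0r.
elim: t => [|y t [n [phi [phiD phiS phiN phit]]]].
  exists 0%N, (fun=> 0); split; [by move=> x y; rewrite addr0| |by []|by []].
  by move=> v; exists 0; apply/matrixP => i [].
have [good|/not_implyP[py Ny]] := pselect (phi y = 0 -> N y).
  by exists n, phi; split => // z; rewrite inE => /orP[/eqP ->//|/phit].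
have [M [[M0 MD] NM My Ms]] := index2_subgroup s sN Ny.
have MC z : ~ M z -> M (y + z).
  have [u us zu] := sP z; case: (Ms u us) => uM nMz.
    by exfalso; apply: nMz; rewrite -(addKK z u); apply: MD => //; apply: NM.
  by rewrite -(addKK z u) addrCA; apply: MD => //; exact: NM.
pose del z : 'F_2 := if `[< M z >] then 0 else 1.
have delD : {morph del : a b / a + b}.
  move=> a b; rewrite /del; case: asboolP => abM; case: asboolP => aM; case: asboolP => bM;
    rewrite ?addr0 ?add0r //.
  - by exfalso; apply: bM; rewrite -(addKK b a) addrC (addrC b); apply: MD.
  - by exfalso; apply: aM; rewrite -(addKK a b); apply: MD.
  - by apply/val_inj.
  - by exfalso; apply: abM; apply: MD.
  - exfalso; apply: abM; rewrite -[a + b]add0r -(char2 y) addrACA.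
    by apply: MD; apply: MC.
have dely : del y = 1 by rewrite /del; case: asboolP.
pose phi' z : 'rV['F_2]_(1 + n) := row_mx (del z)%:M (phi z).
have phi'0 z : phi' z = 0 -> del z = 0 /\ phi z = 0.
  rewrite -[0]row_mx0 => /eq_row_mx[/matrixP/(_ 0 0)]; rewrite !mxE eqxx mulr1n.
  by [].
exists (1 + n)%N, phi'; split.
- by move=> a b; rewrite /phi' delD phiD add_row_mx raddfD.
- move=> v; have [g gv] := phiS (rsubmx v).
  have [dg|dg] := eqVneq (del g) (lsubmx v 0 0).
    by exists g; rewrite /phi' dg gv -mx11_scalar hsubmxK.
  (* Since [phi y = 0] and [del y = 1], adding [y] flips only the new coordinate. *)
  exists (g + y); rewrite /phi' phiD py addr0 gv delD dely.
  rewrite (_ : del g + 1 = lsubmx v 0 0) -?mx11_scalar ?hsubmxK //.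
  by move: dg; case: (del g) (lsubmx v 0 0) => [[|[|//]]] ? [[|[|//]]] ? //= _; apply/val_inj.
- move=> z Nz; rewrite /phi' phiN // /del asboolT; last exact: NM.
  by rewrite raddf0 row_mx0.
- move=> z; rewrite inE => /orP[/eqP ->|zt] /phi'0[dz pz]; last exact: phit.
  by move: dz; rewrite dely.
Qed.

End F2Groups.

(** * Compactness and small open subgroups *)

Section OpenSubgroups.
Variable G : topologicalZmodType.
Hypothesis char2 : forall x : G, x + x = 0.

Lemma addl_continuous (x : G) : continuous (fun z => x + z).
Proof.
move=> z; apply: (@continuous_comp _ _ _ (fun z => (x, z)) (fun p : G * G => p.1 + p.2)).
  by apply: cvg_pair => /=; [exact: cvg_cst|exact: cvg_id].
exact: add_continuous.
Qed.

Lemma nbhs_translate (x : G) (W : set G) : nbhs 0 W -> nbhs x [set z | W (z + x)].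
Proof.
move=> W0; rewrite -(char2 x) in W0; have := @addl_continuous x x W W0.
by rewrite /nbhs /=; apply: filterS => z /=; rewrite addrC.
Qed.

Lemma nbhs0_half (W : set G) : nbhs 0 W ->
  exists2 U, nbhs 0 U & forall a b, U a -> U b -> W (a + b).
Proof.
move=> W0; have := @add_continuous G (0, 0); rewrite /continuous_at /= addr0 => /(_ W W0).
move=> [[U1 U2] /= [U10 U20] sub].
exists (U1 `&` U2); first exact: filterI.
by move=> a b [a1 _] [_ b2]; apply: (sub (a, b)).
Qed.

(** Four summands come from Bogolyubov's argument, the fifth from taking a closure. *)
Lemma nbhs0_fifth (W : set G) : nbhs 0 W ->
  exists2 U, nbhs 0 U & forall a b c d e, U a -> U b -> U c -> U d -> U e ->
    W (a + b + (c + d) + e).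
Proof.
move=> /nbhs0_half[U1 U10 U1W]; have [U2 U20 U2W] := nbhs0_half U10.
have [U3 U30 U3W] := nbhs0_half U20.
exists (U3 `&` U1); first exact: filterI.
by move=> a b c d e [??] [??] [??] [??] [??]; apply: U1W => //; apply: U2W; apply: U3W.
Qed.

Lemma open_subgroup_coset (N : set G) (x : G) : open N -> open [set z | N (x + z)].
Proof.
move=> oN; apply: (@open_comp _ _ (fun z => x + z)) => // z _.
exact: addl_continuous.
Qed.

Lemma finite_translates (U : set G) : compact [set: G] -> nbhs 0 U ->
  exists s : seq G, forall x, exists2 y, y \in s & U (x + y).
Proof.
move=> /compact_near_coveringP cG U0.
pose P (s : seq G) x := exists2 y, y \in s & U (x + y).
have [x _|s0 _ /(_ s0)] := cG _ (@eventually_seq G) P _.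
  exists ([set z | U (z + x)], [set s : seq G | x \in s]) => /=.
    by split; [exact: nbhs_translate|exact: eventually_seq_mem].
  by move=> [z s] /= [zx xs]; exists x.
move=> H; exists s0 => x; exact: H.
Qed.

(** [K] translates of [U] cover [G], so one of them contains at least [1 / K] of any finite
    subgroup. [K] does not depend on the subgroup, so [limit_hom] applies with a fixed number of
    characters. *)
Lemma F2_hom_small_kernel (U : set G) : compact [set: G] -> nbhs 0 U ->
  exists k (gam : G -> 'rV['F_2]_k), {morph gam : x y / x + y} /\
    forall x, gam x = 0 -> exists a b c d, [/\ U a, U b, U c, U d & x = a + b + (c + d)].
Proof.
move=> cG U0; have [ys ysP] := finite_translates cG U0.
pose K := size ys; exists (2 * K ^ 2)%N.
apply: limit_hom => s.
have [m [psi [psiD psiI psiS]]] := F2_span char2 s.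
pose S (y : G) : {set 'rV['F_2]_m} := [set b | `[< U (psi b + y) >]]%SET.
have [y SK] : exists y, (#|{: 'rV['F_2]_m}| <= K * #|S y|)%N.
  apply: contrapT => /forallNP H.
  have lt (t : seq G) : (0 < size t)%N ->
      (size ys * \sum_(y <- t) #|S y| < size t * #|{: 'rV['F_2]_m}|)%N.
    elim: t => // y t IH _; rewrite big_cons mulnDr /= mulSn.
    have /negP := H y; rewrite -ltnNge -/K => Hy.
    case: t IH => [|z t] IH; first by rewrite big_nil muln0 mul0n !addn0.
    by rewrite -addSn leq_add // ltnW // IH.
  have [y0 y0s _] := ysP 0.
  have ys0 : (0 < size ys)%N by case: (ys) y0s.
  have := lt ys ys0; rewrite ltn_pmul2l // ltnNge => /negP; apply.
  have sub : [set: 'rV['F_2]_m]%SET \subset \bigcup_(y <- ys) S y.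
    apply/fintype.subsetP => b _; have [y ys' Uy] := ysP (psi b).
    rewrite (big_rem y) //= finset.inE; apply/orP; left.
    by rewrite finset.inE; apply/asboolP.
  rewrite -cardsT; apply: leq_trans (subset_leq_card sub) _.
  elim: (ys) => [|y t IH]; first by rewrite !big_nil cards0.
  rewrite !big_cons; apply: leq_trans (leq_card_setU _ _) _.
  by rewrite leq_add2l.
have [A AP] := bogolyubov Rdefinitions.R SK.
have inj b : [pick c | psi c == psi b] = Some b.
  case: pickP => [c /eqP /psiI -> //|/(_ b)]; by rewrite eqxx.
(* Points of [s] and their sums lie in the image of [psi]; elsewhere [gam] takes the default value
   [0]. *)
pose gam x := if [pick b | psi b == x] is Some b then b *m A else 0.
have gamE b : gam (psi b) = b *m A by rewrite /gam inj.
exists gam; split.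
  move=> x1 y1 /psiS[b <-] /psiS[c <-]; rewrite -psiD !gamE; exact: mulmxDl.
move=> x /psiS[b <-]; rewrite gamE => /AP[[[s1 s2] [s3 s4]] /= []].
rewrite !finset.inE => /asboolP h1 /asboolP h2 /asboolP h3 /asboolP h4 ->.
(* The four translations by [y] cancel. *)
exists (psi s1 + y), (psi s2 + y), (psi s3 + y), (psi s4 + y); split => //.
by rewrite !psiD; congr (_ + _); rewrite addrACA char2 addr0.
Qed.

(* The kernel of [F2_hom_small_kernel] need not be closed, but its closure has
   finite index, hence is open. *)
Lemma open_subgroup_nbhs0 (W : set G) : compact [set: G] -> nbhs 0 W ->
  exists N, [/\ open N, subgroup2 N & N `<=` W].
Proof.
move=> cG /nbhs0_fifth[U U0 UW].
have [k [gam [gamD gamU]]] := F2_hom_small_kernel cG U0.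
have gam0 : gam 0 = 0 by apply: (addrI (gam 0)); rewrite -gamD !addr0.
pose H := [set x | gam x = 0].
have HD x y : H x -> H y -> H (x + y) by rewrite /H /= gamD => -> ->; rewrite addr0.
pose N := closure H.
have sN : subgroup2 N.
  split; first by apply: subset_closure.
  have step1 x y : H x -> N y -> N (x + y).
    move=> Hx Ny B Bxy; have [z [Hz Bz]] := Ny _ (@addl_continuous x y B Bxy).
    by exists (x + z); split => //; apply: HD.
  move=> x y Nx Ny B /nbhs_interior; rewrite addrC => Bxy.
  have [z [Hz Bz]] := Nx _ (@addl_continuous y x _ Bxy).
  by apply: (step1 z y Hz Ny B); rewrite addrC.
have NW : N `<=` W.
  move=> x /(_ _ (nbhs_translate x U0))[h [/gamU[a [b [c [d [Ua Ub Uc Ud hE]]]]] /= Uhx]].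
  rewrite -(addKK char2 x h) addrC -[x + h]addrC {1}hE.
  exact: UW.
exists N; split => //.
have rep (v : 'rV['F_2]_k) : exists r, (exists x, gam x = v) -> gam r = v.
  have [[x xv]|nx] := pselect (exists x, gam x = v); first by exists x.
  by exists 0 => /nx.
have [r rP] := choice rep.
rewrite -[N]setCK; apply: closed_openC.
(* Each coset of [N] contains a representative [r v] of one of the finitely many values of [gam];
   the cosets other than [N] are closed. *)
have -> : ~` N = \bigcup_(v in [set v | ~ N (r v)]) [set z | N (r v + z)].
  apply/seteqP; split => [x nNx|x [v /= nNr Nrx] Nx].
    have rx : H (r (gam x) + x) by rewrite /H /= gamD rP ?addvv_F2 //; exists x.
    exists (gam x) => /=; last exact: subset_closure.
    move=> Nr; apply: nNx; rewrite -(addKK char2 x (r (gam x))).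
    by case: sN => _; apply => //; rewrite addrC; apply: subset_closure.
  by apply: nNr; rewrite -(addKK char2 (r v) x); case: sN => _; apply.
apply: closed_bigcup; first exact: finite_finset.
move=> v _; apply: (@closed_comp _ _ (fun z => r v + z)); last exact: closed_closure.
by move=> z _; exact: addl_continuous.
Qed.

End OpenSubgroups.

(** * Reduction to a finite quotient *)

Local Notation RR := Rdefinitions.R.

Section FiniteQuotient.
Variables (G : topologicalZmodType) (mu : probability (borel G) RR).
Hypothesis hG : hausdorff_space G.
Hypothesis char2 : forall x : G, x + x = 0.

Let bmeas (X : set G) := measurable (X : set (borel G)).
Let m (X : set G) : RR := fine (mu X).

Lemma open_borel (U : set G) : open U -> bmeas U.
Proof. exact: sub_sigma_algebra. Qed.

Lemma closed_borel (U : set G) : closed U -> bmeas U.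
Proof.
move=> cU; rewrite /bmeas -[U]setCK; apply: measurableC.
by apply: open_borel; apply: closed_openC.
Qed.

Let muE X : bmeas X -> mu X = (m X)%:E.
Proof. by move=> mX; rewrite fineK // fin_num_measure. Qed.

Let m_ge0 X : 0 <= m X.
Proof. by rewrite fine_ge0. Qed.

Let m_le X Y : bmeas X -> bmeas Y -> X `<=` Y -> m X <= m Y.
Proof.
move=> mX mY XY; rewrite -lee_fin -!muE //.
by apply: le_measure; rewrite ?inE.
Qed.

Let m_split X Y : bmeas X -> bmeas Y -> m X = m (X `\` Y) + m (X `&` Y).
Proof.
move=> mX mY; apply: EFin_inj; rewrite EFinD -!muE //.
- exact: measureDI.
- exact: measurableI.
- exact: measurableD.
Qed.

(** Inner regularity is given for open sets, so [K] is taken inside [U] and need not lie in [A]. *)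
Lemma regular_approx (A : set G) (eta : RR) : is_haar_probability mu ->
  bmeas A -> 0 < eta ->
  exists U K, [/\ open U, A `<=` U, compact K, K `<=` U &
    m U <= m A + eta /\ m U <= m K + eta].
Proof.
move=> [_ outer inner] mA eta0.
have finA : mu A \is a fin_num by exact: fin_num_measure.
rewrite outer // in finA.
have [_ [U [oU AU] <-]] := lb_ereal_inf_adherent eta0 finA.
rewrite -outer // => mU.
have finU : mu U \is a fin_num by apply: fin_num_measure; exact: open_borel.
rewrite inner // in finU.
have [_ [K [cK KU] <-]] := ub_ereal_sup_adherent eta0 finU.
rewrite -inner // => mK.
exists U, K; split => //; move: mU mK.
have bK : bmeas K by apply: closed_borel; exact: (compact_closed hG cK).
rewrite (muE mA) (muE (open_borel oU)) (muE bK).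
by rewrite -EFinD -EFinB !lte_fin; lra.
Qed.

(** A small open subgroup [N] then satisfies [K + N] inside [U], so a coset of [N] meeting [K] lies
    in [U]. *)
Lemma compact_translate_sub (K U : set G) : compact K -> open U -> K `<=` U ->
  nbhs 0 [set z | forall x, K x -> U (x + z)].
Proof.
move=> /compact_near_coveringP cK oU KU.
apply: (cK G (nbhs (0 : G)) (fun z x => U (x + z))) => x Kx.
have Ux : nbhs (x + 0) U by rewrite addr0; apply: open_nbhs_nbhs; split => //; apply: KU.
have := @add_continuous G (x, 0) U Ux.
by [].
Qed.

Variables (n : nat) (phi : G -> 'rV['F_2]_n) (N : set G).
Hypotheses (phiD : {morph phi : x y / x + y}) (phiS : forall v, exists x, phi x = v).
Hypotheses (phiN : forall x, phi x = 0 <-> N x) (oN : open N).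

Let V := 'rV['F_2]_n.
Let C (v : V) : set G := [set x | phi x = v].

(** [phi] is locally constant, because its kernel [N] is open. *)
Lemma open_preimage_phi (P : set V) : open [set x | P (phi x)].
Proof.
rewrite openE => x /= Px.
have oc := open_subgroup_coset x oN.
have : nbhs x [set z | N (x + z)].
  by apply: open_nbhs_nbhs; split => //=; rewrite char2; apply/phiN;
     apply: (addrI (phi 0)); rewrite -phiD !addr0.
apply: filterS => z /= /phiN; rewrite phiD => /eqP.
by rewrite addv_eq0 => /eqP <-.
Qed.

Lemma borel_preimage_phi (P : set V) : bmeas [set x | P (phi x)].
Proof. by apply: open_borel; exact: open_preimage_phi. Qed.

Let mC v : bmeas (C v).
Proof. exact: (borel_preimage_phi [set w | w = v]). Qed.

Let mIC X v : bmeas X -> bmeas (X `&` C v).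
Proof. by move=> mX; apply: measurableI => //; exact: mC. Qed.

Lemma sum_fibers X : bmeas X -> \sum_v m (X `&` C v) = m X.
Proof.
move=> mX.
suff H (s : seq V) : uniq s ->
    \sum_(v <- s) m (X `&` C v) = m (X `&` [set x | phi x \in s]).
  rewrite H ?index_enum_uniq //; congr m; apply/seteqP; split => [x []//|x Xx].
  by split => //=; rewrite mem_index_enum.
elim: s => [_|v s IH /= /andP[vs us]].
  rewrite big_nil (_ : _ `&` _ = set0) /m ?measure0 //.
  by apply/seteqP; split => // x [].
rewrite big_cons IH // [RHS](@m_split _ (C v)) //; last first.
  by apply: measurableI => //; apply: (borel_preimage_phi [set w | w \in v :: s]).
rewrite addrC; congr (m _ + m _); apply/seteqP; split => x /=.
- move=> [Xx xs]; split; first by split => //; rewrite inE xs orbT.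
  by rewrite /C /= => xv; rewrite xv (negbTE vs) in xs.
- by move=> [[Xx]]; rewrite inE => /orP[/eqP|].
- by move=> [Xx xv]; split => //; split => //; rewrite /C /= in xv; rewrite xv inE eqxx.
- by move=> [[Xx _] xv].
Qed.

Lemma measure_fiber v : is_haar_probability mu -> m (C v) = #|{: V}|%:R^-1.
Proof.
move=> [inv _ _].
have mCw w : m (C w) = m (C 0).
  have [x xw] := phiS w; rewrite /m -[in RHS](inv x); last exact: mC.
  congr (fine (mu _)); apply/seteqP; split => y.
    move=> yw; exists (x + y); last by rewrite addrA char2 add0r.
    by rewrite /C /= phiD xw yw addvv_F2.
  by move=> [z z0 <-]; rewrite /C /= phiD xw z0 addr0.
have := sum_fibers (@measurableT _ (borel G)).
under eq_bigr do rewrite setTI mCw.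
rewrite sumr_const [m setT](_ : _ = 1); last by rewrite /m probability_setT.
rewrite mCw -[LHS]mulr_natl => E; apply: (mulfI (cardV_neq0 RR n)).
by rewrite mulfV ?cardV_neq0 // -[RHS]E.
Qed.

Variable A : set G.
Hypothesis mA : bmeas A.

(** The density of [A] in the fiber over [v]: every fiber has measure [#|{: V}|%:R^-1] by
    [measure_fiber]. *)
Let f (v : V) : RR := #|{: V}|%:R * m (A `&` C v).

Lemma fourier_indic_phi a :
  fourier_indic mu A (fun x => chi a (phi x)) = (hat f a)%:E.
Proof.
have -> : hat f a = \sum_v chi a v * m (A `&` C v).
  rewrite /hat /mean mulr_sumr; apply: eq_bigr => v _; rewrite /f.
  by rewrite -mulrA mulKf ?cardV_neq0 // mulrC.
rewrite /fourier_indic.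
transitivity (\int[mu]_x (\sum_v ((chi a v)%:E * (\1_(A `&` C v) x)%:E)))%E.
  apply: eq_integral => x _; rewrite -(big_morph _ EFinD (erefl 0%:E)); congr EFin.
  rewrite (bigD1 (phi x)) //= big1 ?addr0 => [|v vx].
    have xC : x \in C (phi x) by apply/mem_set.
    by rewrite !indicE in_setI xC andbT mulrC.
  have /negbTE xC : x \notin C v.
    by apply/negP => /set_mem; rewrite /C /= => E; rewrite E eqxx in vx.
  by rewrite indicE in_setI xC andbF mulr0.
rewrite integral_sum //; last first.
  by move=> v; apply: integrableZl => //; apply: integrable_indic; apply: mIC.
rewrite (big_morph _ EFinD (erefl 0%:E)); apply: eq_bigr => v _.
rewrite integralZl //; last by apply: integrable_indic; apply: mIC.
by rewrite integral_indic ?setIT ?EFinM -?muE //; apply: mIC.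
Qed.

Lemma character_phi a : @character G (fun x => chi a (phi x)).
Proof.
split => [|x|x y]; [|exact: chi_pm|by rewrite phiD chiDr].
apply/continuousP => B _.
exact: (open_preimage_phi [set v | B (chi a v)]).
Qed.

Lemma chi_phi_inj a b : (fun x => chi a (phi x) : RR) = (fun x => chi b (phi x)) -> a = b.
Proof.
move=> ab; apply/eqP; rewrite -addv_eq0; apply/negPn/negP.
move=> /(chi_neq0 RR)[v]; have [x <-] := phiS v; rewrite chiDl.
rewrite (congr1 (fun h : G -> RR => h x) ab) chi_sqr; lra.
Qed.

(** The characters factoring through [phi] are finitely many distinct characters of [G], and their
    coefficients are those of [f]. *)
Lemma sum_hat_le_A_norm : ((\sum_a `|hat f a|)%:E <= A_norm_indic mu A)%E.
Proof.
pose e a : G -> RR := fun x => chi a (phi x).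
apply: esum_ge; exists (e @` setT).
  split; first exact/finite_image/finite_finset.
  by move=> _ [a _ <-]; apply: character_phi.
rewrite fsbig_image; last by move=> a b _ _ /chi_phi_inj.
rewrite (fsbigE (index_enum V)) //; last 2 first.
- exact: index_enum_uniq.
- by move=> a _; rewrite mem_index_enum.
rewrite (eq_bigl xpredT); last by move=> a; rewrite in_setT.
rewrite (big_morph _ EFinD (erefl 0%:E)); apply: lee_sum => a _.
by rewrite fourier_indic_phi.
Qed.

Hypothesis haar : is_haar_probability mu.

Lemma density_bounds v : 0 <= f v <= 1.
Proof.
have N0 := cardV_gt0 RR n; rewrite /f mulr_ge0 ?(ltW N0) ?m_ge0 //=.
rewrite -[leRHS](mulfV (lt0r_neq0 N0)) ler_pM2l // -(measure_fiber v haar).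
by apply: m_le; [exact: mIC|exact: mC|move=> x []].
Qed.

Lemma mean_density : mean f = m A.
Proof.
rewrite -(sum_fibers mA) /mean mulr_sumr; apply: eq_bigr => v _.
by rewrite /f mulKf ?cardV_neq0.
Qed.

(** A fiber meeting [K] lies in [U], so its part outside [A] is in [U] minus [A]; in a fiber missing
    [K], the part in [A] is in [U] minus [K]. Summing over fibers, each difference costs at most
    [eta]. *)
Lemma mean_density_var (U K : set G) (eta : RR) : open U -> compact K ->
  A `<=` U -> K `<=` U -> (forall x z, K x -> N z -> U (x + z)) ->
  m U <= m A + eta -> m U <= m K + eta ->
  mean (fun v => f v * (1 - f v)) <= 2 * eta.
Proof.
move=> oU cK AU KU KNU mUA mUK.
have bU := open_borel oU; have bK := closed_borel (compact_closed hG cK).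
have N0 := cardV_gt0 RR n.
have bUA : bmeas (U `\` A) by apply: measurableD.
have bUK : bmeas (U `\` K) by apply: measurableD.
have le v : #|{: V}|%:R^-1 * (f v * (1 - f v)) <=
    m ((U `\` A) `&` C v) + m ((U `\` K) `&` C v).
  have /andP[f0 f1] := density_bounds v.
  have [[k Kk kv]|nK] := pselect (exists2 k, K k & phi k = v).
    apply: (@le_trans _ _ (m (C v `\` A))).
      have := m_split (mC v) mA; rewrite (measure_fiber v haar) setIC => E.
      have -> : m (C v `\` A) = #|{: V}|%:R^-1 * (1 - f v).
        by rewrite mulrBr mulr1 /f mulKf ?lt0r_neq0 // E addrK.
      rewrite ler_pM2l ?invr_gt0 // ler_piMl //; lra.
    apply: (@le_trans _ _ (m ((U `\` A) `&` C v))); last by rewrite lerDl m_ge0.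
    apply: m_le; [apply: measurableD => //; exact: mC|exact: mIC|].
    move=> x [xv nA]; split => //; split => //.
    rewrite -(addKK char2 x k) addrC.
    apply: KNU => //; apply/phiN; rewrite phiD.
    by rewrite kv xv addvv_F2.
  apply: (@le_trans _ _ (m (A `&` C v))).
    rewrite -[leRHS](mulKf (lt0r_neq0 N0)) ler_pM2l ?invr_gt0 // ler_piMr //; lra.
  apply: (@le_trans _ _ (m ((U `\` K) `&` C v))); last by rewrite lerDr m_ge0.
  apply: m_le; [exact: mIC|exact: mIC|].
  move=> x [Ax xv]; split => //; split; first exact: AU.
  by move=> Kx; apply: nK; exists x.
rewrite /mean mulr_sumr; apply: le_trans (ler_sum _ (fun v _ => le v)) _.
rewrite big_split /= !sum_fibers //.
have := m_split bU mA; have := m_split bU bK.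
rewrite (setIidr AU) (setIidr KU); lra.
Qed.

End FiniteQuotient.

(** * Transfer of the finite bound to compact groups *)

Theorem theorem1p2 :
  exists c : Rdefinitions.R, 0 < c /\
  forall (G : topologicalZmodType) (mu : probability (borel G) Rdefinitions.R)
         (eps : Rdefinitions.R) (A : set G),
    compact_F2_space G -> is_haar_probability mu ->
    0 < eps -> eps <= 100^-1 ->
    measurable (A : set (borel G)) ->
    (`| mu A - (3^-1)%:E | <= eps%:E)%E ->
    ((c * ln (ln (eps^-1)))%:E <= A_norm_indic mu A)%E.
Proof.
exists 100^-1; split; first by rewrite invr_gt0.
move=> G mu eps A [cG hG char2] haar eps0 eps1 mA muA.
have Apos : (0 <= A_norm_indic mu A)%E by apply: esum_ge0 => g _; apply: abse_ge0.
case EM : (A_norm_indic mu A) Apos => [M| |] // M0; last by rewrite leey.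
rewrite lee_fin ler_pdivrMl //.
(* [M] is known before any quotient is chosen, so the precision can be fixed first; halving [4 ^- B]
   matches the [2 * eta] in [mean_density_var]. *)
pose B := (Num.trunc (4 * expR (80 * M))).+1.
pose eta : Rdefinitions.R := 4 ^- B / 2.
have eta0 : 0 < eta by rewrite divr_gt0 // invr_gt0 exprn_gt0.
have [U [K [oU AU cK KU [mUA mUK]]]] := regular_approx hG haar mA eta0.
have [N [oN sN NW]] := open_subgroup_nbhs0 char2 cG (compact_translate_sub cK oU KU).
have [N0 _] := sN.
(* By compactness the open subgroup [N] has finite index, which identifies the quotient with some
   F_2^n. *)
have [s sP] := finite_translates char2 cG (open_nbhs_nbhs (conj oN N0)).
have [n [phi [phiD phiS phiN]]] := F2_quotient char2 sN sP.
apply: (loglog_finite (f := fun v =>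
  #|{: 'rV['F_2]_n}|%:R * fine (mu (A `&` [set x | phi x = v]))) (B := B)) => //.
- exact: (density_bounds char2 phiD phiS phiN oN mA haar).
- by rewrite -lee_fin -EM; apply: (sum_hat_le_A_norm mu char2 phiD phiS phiN oN mA).
- exact/ltW/truncnS_gt.
- have -> : 4 ^- B = 2 * eta by rewrite /eta mulrC divfK.
  apply: (mean_density_var hG char2 phiD phiS phiN oN mA haar oU cK AU KU) => //.
  by move=> x z Kx Nz; apply: NW.
- rewrite (mean_density mu char2 phiD phiN oN mA) -lee_fin.
  by move: muA; rewrite -{1}[mu A]fineK //; apply: fin_num_measure.
Qed.
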